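(* Let $(m,n)$ be a coprime pair of positive integers with $m=kn+d$, $k\ge 1$, $1\le d<n$. The following algorithm (the ReciPhi algorithm) takes as input an SW-sequence $\sigma\in\mathcal{D}_{m,n}$, determines whether a rank sequence $\mathfrak r$ compatible with $\sigma$ exists, and outputs $\mathfrak r$ if it exists. (1) If $\sigma=S^nW^m$, then output $\mathfrak r=(0,1,\dots,m+n-1)$. (2) Let $f_0=1$ and $f_i=\sigma^{-1}(W_{f_{i-1}})$ for $1\le i\le k+1$. Take $s=f_1$, the position of $n$ (that is, $\mathfrak r_s=n$), and $a=f_{k+1}$, the position of $kn+n$ (that is, $\mathfrak r_a=kn+n$). Let $C=\{c: a<\sigma^{-1}(S_{c+1})\text{ and }\sigma^{-1}(S_c)<a+d\}$, where $\sigma^{-1}(S_{n+1})$ is set to be $m+n+1$. (3) For each $c\in C$, as a candidate for $\mathrm{key}(R)$, let $I_c=[\sigma^{-1}(S_c),\sigma^{-1}(S_{c+1})-1]$. Let $\sigma'$ be obtained from $\sigma$ by inserting a $W$ after $S_c$ and then removing $\sigma_s=W$. If $\sigma'\ne\sigma$, then recursively construct $\mathfrak r'=\mathfrak r(\sigma')$, the rank sequence the algorithm gives for $\sigma'$. Find the position $\delta$ such that $\mathfrak r'_\delta=\mathfrak r'_{s-1}+m$. If $\sigma'_\delta=W$ and $\delta\in I_c$, then $\sigma'$ is the desired SW-sequence $\sigma^L$ of $\mathcal L(R)$, and output $$\mathfrak r=(0,\ \mathfrak r'_1+t,\dots,\mathfrak r'_{\delta-1}+t,\ \mathfrak r'_{\delta+1}+t,\dots,\mathfrak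 r'_{m+n}+t),\qquad t=n-\mathfrak r'_{s-1}.$$ (4) If no $\mathfrak r$ can be found in step (3), then there is no $\mathfrak r$ compatible with $\sigma$. Moreover, if $\sigma(D)=\sigma$ for an $(m,n)$-Dyck path $D$, then the search tree has depth $\mathrm{area}(\mathfrak c(D))$ and each node has at most $d$ children (corresponding to the choices of $\delta$), so that in the worst case one searches a $d$-ary tree of depth $\mathrm{area}(\mathfrak c(D))$.
   Context: An $(m,n)$-Dyck path is a lattice path from $(0,0)$ to $(m,n)$ with unit north steps $u$ and unit east steps $d$ that never goes below $y=\frac nm x$; $\mathcal{D}_{m,n}$ is the set of them, written as words in $u,d$. The rank of a lattice point $(a,b)$ is $mb-na$. For a Dyck path $D$ visiting the lattice points $P_0=(0,0),P_1,\dots,P_{m+n}=(m,n)$, its rank set is $R(D)=\{\text{ranks of }P_0,\dots,P_{m+n-1}\}$, a set of $m+n$ distinct nonnegative integers; $D$ is identified with $R(D)$. $\mathrm{sort}(R)=(\mathfrak r_1<\dots<\mathfrak r_{m+n})$ is the increasing rearrangement of $R$. The SW-sequence $\sigma(D)=(\sigma_1,\dots,\sigma_{m+n})$, also written $\sigma(R)$ for $R=R(D)$, has $\sigma_i=S$ if $\mathfrak r_i$ is the rank of the starting point of a $u$ step of $D$, and $\sigma_i=W$ if it is the rank of the starting point of a $d$ step. (The sweep map sends $D$ to $\sigma(D)$ with $S$ replaced by $u$ and $W$ by $d$.) $\mathrm{area}(D)$ is the number of lattice squares to the right of $D$ and to the left of the diagonal. The rank complement $\mathfrak c(D)$ is the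 $(m,n)$-Dyck path with rank set $\{\max R(D)-r: r\in R(D)\}$. $\mathrm{key}(R)$ is the number of ranks in $R\cap\{0,\dots,m+n\}$ that are starting points of $u$ steps. For $R\neq\{0,1,\dots,m+n-1\}$, $\mathcal L(R)$ is the rank set obtained from $(R\setminus\{0\})\cup\{m+n\}$ by subtracting $\min(R\setminus\{0\})$ from every element. In general an SW-sequence is a word $\sigma$ of length $m+n$ with $n$ letters $S$ and $m$ letters $W$; $\sigma\in\mathcal{D}_{m,n}$ means that replacing $S$ by $u$ and $W$ by $d$ gives an $(m,n)$-Dyck path. The $i$-th $S$ from the left is labelled $S_i$, the $j$-th $W$ is labelled $W_j$, and $\sigma^{-1}(S_i)$, $\sigma^{-1}(W_j)$ denote their positions in $\sigma$. For a set $R\ni 0$ of $m+n$ nonnegative integers with $\mathfrak r=\mathrm{sort}(R)$, put $\mathfrak r(S_i)=\mathfrak r_{\sigma^{-1}(S_i)}$ and $\mathfrak r(W_j)=\mathfrak r_{\sigma^{-1}(W_j)}$. The set $R$ (or the sequence $\mathfrak r$) is compatible with $\sigma$ if $\mathfrak r(S_i)+m\in R$ for $1\le i\le n$ and $\mathfrak r(W_j)-n\in R$ for $1\le j\le m$.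
   Formalization: The full search tree can be deeper than area(c(D)) (e.g. (5,3), SWSWSWWW: depth 3, area 2); so it is shown that the output is reached at depth area(c(D)) for any order of candidates, and that the tree has exactly this depth if candidates c are tried from largest to smallest. *)

(* Defs.v *)
From mathcomp Require Import all_boot.

Set Implicit Arguments.
Unset Strict Implicit.
Unset Printing Implicit Defensive.

(* Lattice paths and SW-sequences are both words over bool: true is u (north)
   or S, false is d (east) or W, so replacing S by u and W by d is the
   identity. Positions and the labels S_i, W_j are counted from 1. *)
Definition word := seq bool.

Definition is_dyck (m n : nat) (w : word) : bool :=
  [&& count_mem true w == n, count_mem false w == m
    & all (fun i => n * count_mem false (take i w)
                    <= m * count_mem true (take i w))
          (iota 0 (size w).+1)].

(* The truncated subtraction is exact for Dyck paths. *)
Definition point_rank (m n : nat) (w : word) (i : nat) : nat :=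
  m * count_mem true (take i w) - n * count_mem false (take i w).

Definition ranks (m n : nat) (D : word) : seq nat :=
  [seq point_rank m n D i | i <- iota 0 (m + n)].

Definition sorted_ranks (m n : nat) (D : word) : seq nat :=
  sort leq (ranks m n D).

Definition sw (m n : nat) (D : word) : word :=
  [seq nth false D (index x (ranks m n D)) | x <- sorted_ranks m n D].

(* The position of the j-th letter b (1 <= j); it is (size w).+1 when w has
   fewer than j letters b, which gives the convention for S_{n+1}. *)
Definition pos (b : bool) (j : nat) (w : word) : nat :=
  (nth (size w) [seq i <- iota 0 (size w) | nth (~~ b) w i == b] j.-1).+1.

(* The unit square with lower left corner (a, b) is right of D if the north
   step of D from height b has abscissa at most a, and it is left of the
   diagonal if its lower right corner (a + 1, b) is. *)
Definition area (m n : nat) (D : word) : nat :=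
  count (fun ab : nat * nat =>
           (count_mem false (take (pos true ab.2.+1 D) D) <= ab.1)
           && (n * ab.1.+1 <= m * ab.2))
        [seq (a, b) | a <- iota 0 m, b <- iota 0 n].

Definition is_rank_complement (m n : nat) (D E : word) : Prop :=
  is_dyck m n E /\
  ranks m n E =i [seq (\max_(y <- ranks m n D) y) - x | x <- ranks m n D].

Definition key (m n : nat) (D : word) : nat :=
  count (fun i => nth false D i && (point_rank m n D i <= m + n))
        (iota 0 (m + n)).

(* L(R), listed increasingly; R is a list without repetition. *)
Definition Lop (m n : nat) (R : seq nat) : seq nat :=
  let R1 := rem 0 R in
  let mu := head 0 (sort leq R1) in
  sort leq [seq x - mu | x <- rcons R1 (m + n)].

(* The i-th term of a sequence, counted from 1. *)
Definition term (r : seq nat) (i : nat) : nat := nth 0 r i.-1.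

Definition compatible (m n : nat) (sigma : word) (r : seq nat) : bool :=
  [&& size r == m + n, sorted ltn r, 0 \in r,
      all (fun i => term r (pos true i sigma) + m \in r) (iota 1 n)
    & all (fun j => let x := term r (pos false j sigma) in
                    (n <= x) && (x - n \in r)) (iota 1 m)].

Definition top_word (m n : nat) : word := nseq n true ++ nseq m false.

(* fpos sigma i is f_i. Below, k is m %/ n and d is m %% n. *)
Definition fpos (sigma : word) (i : nat) : nat :=
  iter i (fun j => pos false j sigma) 1.

Definition s_pos (sigma : word) : nat := fpos sigma 1.

Definition a_pos (m n : nat) (sigma : word) : nat := fpos sigma (m %/ n).+1.

Definition candidates (m n : nat) (sigma : word) : seq nat :=
  let a := a_pos m n sigma in
  [seq c <- iota 1 n |
     (a < pos true c.+1 sigma) && (pos true c sigma < a + m %% n)].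

(* Insert a W after S_c, then delete the letter that was at position s in
   sigma; it is at position q of the lengthened word. *)
Definition child (sigma : word) (c : nat) : word :=
  let p := pos true c sigma in
  let s := s_pos sigma in
  let sigma1 := take p sigma ++ false :: drop p sigma in
  let q := if s <= p then s else s.+1 in
  take q.-1 sigma1 ++ drop q sigma1.

(* Here t = n - x. The truncation is harmless: the s - 1 first letters of sigma'
   are S, and n is the rank of the first W of a compatible sequence, so x < n. *)
Definition accept (m n : nat) (sigma : word) (c : nat) (sigma' : word)
    (r' : seq nat) : option (seq nat) :=
  let x := term r' (s_pos sigma).-1 in
  let delta := (index (x + m) r').+1 in
  if [&& x + m \in r',
         nth true sigma' delta.-1 == false,
         pos true c sigma <= delta & delta <= (pos true c.+1 sigma).-1]
  then Some (0 :: [seq y + (n - x) | y <- take delta.-1 r' ++ drop delta r'])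
  else None.

(* The tree of the recursive calls: a node carries the input of the call and
   the subtrees of the calls it makes, in chronological order. *)
Inductive search_tree : Type := Node of word & seq search_tree.

Fixpoint depth (t : search_tree) : nat :=
  let: Node _ ts := t in foldr (fun u h => maxn (depth u).+1 h) 0 ts.

Fixpoint max_children (t : search_tree) : nat :=
  let: Node _ ts := t in
  maxn (size ts) (foldr (fun u h => maxn (max_children u) h) 0 ts).

(* The length of the branch of last children. A call stops at the first
   accepted candidate, so if there is an output this is the branch that
   produces it. *)
Fixpoint output_depth (t : search_tree) : nat :=
  let: Node _ ts := t in foldl (fun _ u => (output_depth u).+1) 0 ts.

(* The loop over the candidates. The outer None means that the fuel of a
   recursive call is exhausted, the inner None that nothing was found. *)
Definition try_candidates (m n : nat)
    (rec : word -> option (option (seq nat) * search_tree)) (sigma : word) :=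
  fix loop (cs : seq nat) : option (option (seq nat) * seq search_tree) :=
    if cs is c :: cs' then
      let sigma' := child sigma c in
      if sigma' == sigma then loop cs' else
      if rec sigma' is Some (o', t') then
        if obind (accept m n sigma c sigma') o' is Some r
        then Some (Some r, [:: t'])
        else if loop cs' is Some (o, ts) then Some (o, t' :: ts) else None
      else None
    else Some (None, [::]).

(* The order in which the candidates are tried is left to the parameter
   order. *)
Fixpoint reciphi (m n : nat) (order : word -> seq nat -> seq nat)
    (fuel : nat) (sigma : word) : option (option (seq nat) * search_tree) :=
  if fuel is fuel'.+1 then
    if sigma == top_word m n
    then Some (Some (iota 0 (m + n)), Node sigma [::])
    else if try_candidates m n (reciphi m n order fuel') sigma
              (order sigma (candidates m n sigma)) is Some (o, ts)
         then Some (o, Node sigma ts) else None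
  else None.

Definition halts_with (m n : nat) (order : word -> seq nat -> seq nat)
    (sigma : word) (o : option (seq nat)) (t : search_tree) : Prop :=
  exists N, forall fuel, N <= fuel -> reciphi m n order fuel sigma = Some (o, t).

(* Main.v *)
Require Import Defs.
From mathcomp Require Import all_boot.
From mathcomp Require Import zify.

(** A sequence compatible with a word is the same thing as the sorted rank set
    of a Dyck path, and L removes the rank 0 from a rank set, adds m + n and
    shifts. The algorithm is therefore correct as soon as a word determines
    its rank set, and the trees of the rejected candidates are shallow if
    moving letters W to the right does not increase the area of the rank
    complement.

    Both facts follow from a comparison of profiles. A rank set with maximum M
    meets each class modulo m + n once; let a(i) be the number of levels M - j
    with j < i that are at most the rank of their class. If T(q) is the number
    of S among the last q letters of the word, then
    a(q) = a(q - n) + T(a(q + m) - a(q - n)). Moreover a determines the rank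
    set, and i - a(i) is the area of the rank complement for large i. The
    equation is monotone in a and in T, so that one profile can be slid towards
    another one until they touch, and the contact points give a contradiction.

    The sweep map is then injective on Dyck paths, and it sends them to Dyck
    paths, so it is onto: every input of a recursive call has an answer, and
    only the candidate key(R) is ever accepted. The area of the rank complement
    drops by 1 under L, hence it is the depth of the branch of the output. *)

Set Implicit Arguments.
Unset Strict Implicit.
Unset Printing Implicit Defensive.

(** The profile is taken of the complement M - R because of the shape of its equation. For R itself,
    with T counting the S among the first letters, the same count gives a(q) = a(q - n) + T(a(q) -
    a(q - m - n)), where a(q) stands on both sides and a contact at q could be its own cause. In the
    complement a(q) depends on a(q - n) and a(q + m) only, and increasingly on both, since T is
    1-Lipschitz. A delayed profile solves the same equation, so the word alone leaves a translation
    open. The two ends fix it: far away a(i) is i minus the defect, and a(1) = 1 because 0 lies in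
    the complement. This is why defects are compared before profiles, and why the monotonicity of
    the area is a step of the injectivity proof. That a contact point is caused by another one is no
    contradiction by itself. The contradiction comes from runs of consecutive contact points: they
    would get arbitrarily long, while all contact points lie in a bounded interval. *)

Lemma orbit_mod (m N u x : nat) : 0 < m -> 0 < N -> coprime m N ->
  exists k, u + k * m = x %[mod N].
Proof.
move=> m0 N0 /(coprimeP _ m0)[[k l] /= e].
have {}e : k * m = 1 + l * N by lia.
exists (k * (x + N.-1 * u)); rewrite mulnAC e.
case: N N0 e => // N _ e.
have -> : u + (1 + l * N.+1) * (x + N * u)
  = (u + l * (x + N * u)) * N.+1 + x by lia.
by rewrite modnMDl.
Qed.

(** * Comparison of profiles *)

Definition lip (T : nat -> nat) := forall q, T q <= T q.+1 <= (T q).+1.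

Lemma lip_mono (T : nat -> nat) (x y : nat) : lip T -> x <= y -> T x <= T y.
Proof.
move=> hT /subnKC <-; elim: (y - x) => [|j ih]; first by rewrite addn0.
by rewrite addnS; have /andP[] := hT (x + j); lia.
Qed.

Lemma lip_le (T : nat -> nat) (x y : nat) :
  lip T -> x <= y -> T y <= T x + (y - x).
Proof.
move=> hT /subnKC <-; elim: (y - x) => [|j ih]; first by rewrite addn0; lia.
by rewrite addnS; have /andP[] := hT (x + j); lia.
Qed.

(* As a 0 = 0, truncating q - n amounts to extending a by 0. *)
Definition profile (m n : nat) (T a : nat -> nat) :=
  [/\ a 0 = 0, lip a,
      forall i, a i < a i.+1 -> a (i + m) < a (i + m).+1,
      forall i, a i < a i.+1 -> a (i + (m + n)) < a (i + (m + n)).+1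
    & forall q, a q = a (q - n) + T (a (q + m) - a (q - n))].

Section Touching.
Variables (m n i0 : nat) (T1 T2 a b : nat -> nat).
Hypotheses (m_gt0 : 0 < m) (co_mn : coprime m (m + n)).
Hypotheses (lipT1 : lip T1) (lipT2 : lip T2) (leT : forall q, T1 q <= T2 q).
Hypotheses (pa : profile m n T1 a) (pb : profile m n T2 b).
Hypotheses (slide : forall i, a i <= b i.+1)
  (low : forall i, i0 <= i -> a i <= b i).

(* Z is the set of contact points; p sends a contact point to one of the two
   contact points that cause it. Consecutive contact points move in parallel
   under p. A run of them can be prolonged, since otherwise b would increase
   only where a does, although a <= b far away. *)
Let Z q := a q == (b q).+1.
Let p q := if Z (q + m) then q + m else q - n.

Let a0 : a 0 = 0. Proof. by case: pa. Qed.
Let lipa : lip a. Proof. by case: pa. Qed.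
Let lipb : lip b. Proof. by case: pb. Qed.

Let leZ q : a q <= (b q).+1.
Proof. by apply: leq_trans (slide q) _; case/andP: (lipb q). Qed.

Let gt0Z q : Z q -> 0 < q.
Proof. by rewrite /Z; case: q => //; rewrite a0. Qed.

Let ltZ q : Z q -> q < i0.
Proof. by move=> /eqP z; rewrite ltnNge; apply/negP => /low; lia. Qed.

(** [slide] bounds [a] one place earlier by [b q], so at a contact [a] has just increased. *)
Let preZ q : Z q -> a q.-1 < a q.
Proof.
case: q => [/gt0Z //|q] /= /eqP z.
by have := slide q; lia.
Qed.

Let predZ q : Z q -> Z q.-1 = (b q.-1 < b q).
Proof.
case: q => [/gt0Z //|q] zq; have /= := preZ zq; move: zq; rewrite /Z /=.
by move=> /eqP zq lt; have /andP[] := lipa q; have /andP[] := lipb q; lia.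
Qed.

(** Without contact at [q + m] and [q - n], [a] is at most [b] at both points. Replacing [a] by [b]
    on the right of the equation cannot lower it: raising [a (q - n)] costs [T1] at most as much as
    it adds. *)
Let backZ q : Z q -> Z (p q).
Proof.
rewrite /p; case: ifP => // nz /eqP zq; apply/eqP.
case: pa => _ _ _ _ /(_ q) ea; case: pb => _ _ _ _ /(_ q) eb.
move: nz ea eb; set i := q - n; rewrite /Z => nz ea eb.
have h1 := leZ (q + m); have h2 := leZ i.
have h3 : a i <= a (q + m) by apply: lip_mono lipa _; lia.
have h4 : b i <= b (q + m) by apply: lip_mono lipb _; lia.
case: (ltnP (b i) (a i)) => [|h5]; first by lia.
have h6 : T1 (a (q + m) - a i) <= T1 (b (q + m) - a i).
  by apply: lip_mono lipT1 _; lia.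
have h7 := @lip_le T1 (b (q + m) - b i) (b (q + m) - a i) lipT1.
by have h8 := leT (b (q + m) - b i); lia.
Qed.

(* A failure would mean that T2 increases between two arguments at which the
   equations for a and b prescribe equal values of T1 and T2. *)
Let pairZ q : Z q -> Z q.-1 -> p q.-1 = (p q).-1 /\ Z (p q).-1.
Proof.
move=> zq zq1; have q0 := gt0Z zq; have q10 := gt0Z zq1.
have zp := backZ zq; move: zp; rewrite /p; case: ifP => zm zp.
  have -> : q.-1 + m = (q + m).-1 by lia.
  suff -> : Z (q + m).-1 by [].
  (* By [predZ], contact at the predecessor is an increase of [b], and increases of [b] persist
     under adding [m]. *)
  rewrite predZ //; move: zq1; rewrite predZ // => lt.
  case: pb => _ _ /(_ q.-1) h _ _; move: h.
  have -> : (q.-1 + m).+1 = q + m by lia.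
  have -> : q.-1 + m = (q + m).-1 by lia.
  by apply; rewrite prednK.
have i_gt0 := gt0Z zp; set i := q - n in zp i_gt0 *.
have e1 : q.-1 - n = i.-1 by rewrite /i; lia.
have e2 : q.-1 + m = (q + m).-1 by lia.
have e3 : (q + m).-1.+1 = q + m by lia.
have lab := preZ zp.
(* The increase of [a] just before [i = q - n] recurs [m + n] later, just before [q + m]. *)
have lac : a (q + m).-1 < a (q + m).
  case: pa => _ _ _ /(_ i.-1) h _; move: h.
  have -> : (i.-1 + (m + n)).+1 = q + m by rewrite /i in i_gt0 *; lia.
  have -> : i.-1 + (m + n) = (q + m).-1 by rewrite /i in i_gt0 *; lia.
  by apply; rewrite prednK.
(* After a contact at [(q + m).-1] the increase of [a] would force one of [b], and [q + m] would be
   a contact too. *)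
have nz1 : Z (q + m).-1 = false.
  apply/negP => /eqP z1; move/negP: zm; apply; apply/eqP.
  have := leZ (q + m); have /andP[] := lipb (q + m).-1; rewrite e3.
  have := leZ (q + m).-1; rewrite z1.
  move=> h1 h2 h3.
  by have /andP[] := lipa (q + m).-1; rewrite e3; lia.
rewrite e2 nz1 e1; split=> //; rewrite predZ //.
case: ltnP => // leb; exfalso.
have ebi : b i.-1 = b i by have /andP[] := lipb i.-1; rewrite prednK; lia.
case: pa => _ _ _ _ /(_ q) ea; case: pb => _ _ _ _ h.
have eb := h q; have eb1 := h q.-1; rewrite -/i in ea eb.
rewrite e1 e2 ebi in eb1.
have lbq : b q.-1 < b q by rewrite -predZ.
have /andP[g1 g2] := lipb (q + m).-1; rewrite e3 in g1 g2.
have h4 : b i <= b (q + m).-1 by rewrite -ebi; apply: lip_mono lipb _; rewrite /i; lia.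
have h1 := leZ (q + m); move/eqP: zq => zq; move/eqP: zp => zp.
move: zm; rewrite /Z => zm.
have h5 : a i <= a (q + m) by apply: lip_mono lipa _; rewrite /i; lia.
have h6 : T1 (a (q + m) - a i) <= T1 (b (q + m).-1 - b i).
  apply: lip_mono lipT1 _.
  have : b (q + m).-1 != b (q + m).
    by apply/eqP => eqb; move: eb1; rewrite eqb -eb; lia.
  by lia.
by have h7 := leT (b (q + m).-1 - b i); lia.
Qed.

Let run J q := forall j, j <= J -> Z (q - j).

Let run_p J q : run J q -> p (q - J) = p q - J /\ run J (p q).
Proof.
elim: J => [|J ih] h.
  rewrite !subn0; split=> // j; rewrite leqn0 => /eqP ->; rewrite subn0.
  by apply: backZ; have := h 0; rewrite subn0; apply.
have [|e1 r1] := ih; first by move=> j jJ; apply: h; lia.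
have [||e2 z2] := @pairZ (q - J); [by apply: h; lia | |].
  by have := h J.+1 (leqnn _); rewrite subnS.
rewrite subnS e2 e1 -subnS; split=> // j; rewrite leq_eqVlt => /orP[/eqP ->|].
  by rewrite subnS -e1.
by rewrite ltnS => /r1.
Qed.

Let run_iter J q k : run J q -> run J (iter k p q).
Proof. by move=> h; elim: k => //= k ih; have [] := run_p ih. Qed.

Let stepZ q : Z q -> p q = q + m \/ p q + n = q.
Proof.
move=> zq; have := gt0Z (backZ zq); rewrite /p; case: ifP => _ h; [by left|].
by right; lia.
Qed.

Let run_mod J q k : run J q ->
  iter k p q - J = (q - J) + k * m %[mod m + n].
Proof.
move=> h; elim: k => [|k ih]; first by rewrite addn0.
have hk := run_iter k h; have [e _] := run_p hk; rewrite iterS -e.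
have [->|e2] := stepZ (hk J (leqnn _)).
  have -> : q - J + k.+1 * m = q - J + k * m + m by lia.
  by rewrite -modnDml ih modnDml.
apply/eqP; rewrite -(eqn_modDr n) e2 ih mulSn; apply/eqP.
have -> : q - J + (m + k * m) + n = q - J + k * m + (m + n) by lia.
by rewrite modnDr.
Qed.

Let up (f : nat -> nat) (hf : forall i, f i < f i.+1 ->
    f (i + (m + n)) < f (i + (m + n)).+1) x y :
  x <= y -> x = y %[mod m + n] -> f x < f x.+1 -> f y < f y.+1.
Proof.
move=> xy /eqP; rewrite eq_sym eqn_mod_dvd // => /dvdnP[k e] lt.
have -> : y = x + k * (m + n) by lia.
elim: k {e} => [|k ih]; first by rewrite addn0.
by rewrite mulSn [_ + k * _]addnC addnA; apply: hf.
Qed.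

Let run_grow J q : run J q -> exists q', run J.+1 q'.
Proof.
move=> h; case: (boolP [exists k : 'I_(m + n), Z (iter k p q - J).-1]).
  move=> /existsP[k zk]; exists (iter k p q) => j.
  rewrite leq_eqVlt => /orP[/eqP ->|]; first by rewrite subnS.
  by rewrite ltnS; apply: run_iter.
rewrite negb_exists => /forallP nz.
pose u k := iter k p q - J.
have um l : u l = u 0 + l * m %[mod m + n] by exact: run_mod.
have Zu k : Z (u k) := run_iter k h (leqnn J).
have nzu k : exists2 k', u k' = u k %[mod m + n] & ~~ Z (u k').-1.
  have mn0 : 0 < m + n by lia.
  exists (k %% (m + n)); last by have := nz (Ordinal (ltn_pmod k mn0)).
  by rewrite !um -modnDmr modnMml modnDmr.
(* The bottoms [u k] of the moved runs reach every residue class, since [m] is invertible modulo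
   [m + n]. Just below a bottom there is no contact, so there [a] increases and [b] does not. *)
have key x : exists2 w, w = x %[mod m + n] &
    (a w < a w.+1) && (b w.+1 <= b w).
  have [|k ek] := orbit_mod (u 0) x.+1 m_gt0 _ co_mn; first by lia.
  have [k' ek' nk'] := nzu k.
  have u0 := gt0Z (Zu k'); exists (u k').-1.
    apply/eqP; rewrite -(eqn_modDr 1) !addn1 prednK // ek' -ek.
    exact/eqP/um.
  have := preZ (Zu k'); have := predZ (Zu k'); rewrite prednK //.
  by rewrite (negPf nk') => /esym/negbT; rewrite -leqNgt => -> ->.
(* Increases persist upwards in a class. If [x <= w], then [b] would increase at [w]; otherwise the
   increase of [a] at [w] reaches [x]. *)
have sub x : b x < b x.+1 -> a x < a x.+1.
  move=> bx; have [w ew /andP[aw bw]] := key x.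
  case: pa => _ _ _ ha _; case: pb => _ _ _ hb _.
  case: (leqP x w) => xw; first by have := @up b hb _ _ xw (esym ew) bx; lia.
  exact: (@up a ha _ _ (ltnW xw) ew aw).
have mono i j : i <= j -> b i < a i -> b j < a j.
  move=> /subnKC <-; elim: (j - i) => [|l ih] lt; first by rewrite addn0.
  have := ih lt; rewrite addnS; set t := i + l.
  have := sub t; have /andP[] := lipa t; have /andP[] := lipb t; lia.
have /eqP z0 := Zu 0.
have := @mono (u 0) (u 0 + i0) (leq_addr _ _); have := low (leq_addl (u 0) i0).
by lia.
Qed.

Lemma touching i : a i <= b i.
Proof.
rewrite leqNgt; apply/negP => lt.
have zi : Z i by apply/eqP; have := leZ i; lia.
have : forall J, exists q, run J q.
  elim=> [|J [q /run_grow //]].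
  by exists i => j; rewrite leqn0 => /eqP ->; rewrite subn0.
(* Contact points lie strictly between 0 and [i0], which leaves no room for [i0 + 1] consecutive
   ones. *)
move=> /(_ i0)[q h]; have := ltZ (h 0 isT); have := gt0Z (h i0 (leqnn _)).
lia.
Qed.

End Touching.

Lemma profile_shift (m n s : nat) (T a : nat -> nat) :
  lip T -> profile m n T a -> profile m n T (fun i => a (i - s)).
Proof.
move=> lipT [a0 lipa am aN eq].
have out i : i < s -> (i - s = 0) * (i.+1 - s = 0).
  by move=> lt; split; clear -lt; lia.
split=> [|i|i|i|q].
- by rewrite sub0n.
- case: (ltnP i s) => [/out[-> ->]|si]; first by rewrite leqnn leqnSn.
  by rewrite subSn.
- case: (ltnP i s) => [/out[-> ->]|si]; first by rewrite ltnn.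
  by rewrite subSn // => /am; rewrite addnBAC // subSn // (leq_trans si) ?leq_addr.
- case: (ltnP i s) => [/out[-> ->]|si]; first by rewrite ltnn.
  by rewrite subSn // => /aN; rewrite addnBAC // subSn // (leq_trans si) ?leq_addr.
case: (leqP s q) => sq; first by rewrite (eq (q - s)) subnAC -addnBAC.
have -> : q - s = 0 by lia.
have -> : q - n - s = 0 by lia.
(* The equation at 0 says that [T (a m) = 0]; for [q < s] the argument of [T] is at most [a m]. *)
rewrite a0 subn0; have := eq 0; rewrite ?sub0n !a0 subn0 !add0n => T0.
have le : a (q + m - s) <= a m by apply: lip_mono lipa _; lia.
by have := lip_mono lipT le; rewrite -T0; lia.
Qed.

(** Delayed by [i0], [a] is below [b]: it vanishes before [i0], and from there on [low] applies. The
    delay is then undone one unit at a time, which is the situation of [touching]. *)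
Lemma profile_le (m n i0 : nat) (T1 T2 a b : nat -> nat) :
  0 < m -> coprime m (m + n) -> lip T1 -> lip T2 ->
  (forall q, T1 q <= T2 q) -> profile m n T1 a -> profile m n T2 b ->
  (forall i, i0 <= i -> a i <= b i) -> forall i, a i <= b i.
Proof.
move=> m0 co l1 l2 T12 pa pb low.
have a0 : a 0 = 0 by case: pa.
have lipa : lip a by case: pa.
suff H s : (forall i, a (i - s) <= b i) -> forall i, a i <= b i.
  apply: (H i0) => i; case: (leqP i0 i) => [/low|]; last by move/ltnW/eqP->; rewrite a0.
  by apply: leq_trans; apply: lip_mono lipa _; lia.
elim: s => [|s ih] h; first by move=> i; have := h i; rewrite subn0.
apply: ih; apply: (@touching m n i0 T1 T2) => //.
- exact: profile_shift.
- by move=> i; have := h i.+1; rewrite subSS.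
by move=> i /low; apply: leq_trans; apply: lip_mono lipa _; lia.
Qed.

(** If [c2 < c1], then [b] delayed by [c1 - c2] agrees with [a] far away, hence bounds [a]
    everywhere; but at 1 the delayed [b] is still 0. *)
Lemma profile_defect_le (m n i0 c1 c2 : nat) (T1 T2 a b : nat -> nat) :
  0 < m -> coprime m (m + n) -> lip T1 -> lip T2 ->
  (forall q, T1 q <= T2 q) -> profile m n T1 a -> profile m n T2 b ->
  (forall i, i0 <= i -> a i + c1 = i) -> (forall i, i0 <= i -> b i + c2 = i) ->
  a 1 = 1 -> c1 <= c2.
Proof.
move=> m0 co l1 l2 T12 pa pb ha hb a1; rewrite leqNgt; apply/negP => lt.
have := @profile_le m n (i0 + (c1 - c2)) T1 T2 a (fun i => b (i - (c1 - c2)))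
  m0 co l1 l2 T12 pa (profile_shift _ l2 pb).
have b0 : b 0 = 0 by case: pb.
move=> /(_ _ 1); rewrite a1 (_ : 1 - _ = 0) ?b0; last by lia.
move=> H; suff: 0 < 0 by []; apply: H => i hi.
have := ha i; have := hb (i - (c1 - c2)); lia.
Qed.

(** * Rank sets *)

(** Only a local condition is imposed: from every element a north or an east step leads back into
    the set. Coprimality turns this into a single closed path. *)
Definition rank_set (m n : nat) (R : seq nat) :=
  [&& uniq R, size R == m + n
    & all (fun x => (x + m \in R) || (n <= x) && (x - n \in R)) R].

Definition step (m n : nat) (R : seq nat) (x : nat) :=
  if x + m \in R then x + m else x - n.

(* A rank set contains exactly one element e of each class modulo m + n;
   [above j] says that e <= j for the class of j. *)
Definition above (m n : nat) (R : seq nat) (j : nat) :=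
  has (fun e => (e <= j) && (e == j %[mod m + n])) R.

Definition prof (m n : nat) (R : seq nat) (j : nat) :=
  count (above m n R) (iota 0 j).

Definition flip (M : nat) (R : seq nat) := [seq M - x | x <- R].

(* The number of j that are not above R, counted along the classes modulo n;
   it is the area of a path with ranks R. *)
Definition defect (m n : nat) (R : seq nat) :=
  \sum_(x <- R | x + m \in R) x %/ n.

Lemma count_ltnS (P : pred nat) (R : seq nat) (j : nat) : uniq R ->
  count (fun x => P x && (x < j.+1)) R
    = count (fun x => P x && (x < j)) R + (P j && (j \in R)).
Proof.
elim: R => [|x R ih] /=; first by rewrite andbF.
move=> /andP[xR /ih ->]; rewrite in_cons ltnS leq_eqVlt.
case: (eqVneq j x) => [->|]; first by rewrite (negPf xR) ltnn /= !andbF !andbT; lia.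
by move=> _ /=; rewrite addnA.
Qed.

Lemma sum_count (T : Type) (P : pred T) (R : seq T) :
  \sum_(x <- R) (P x : nat) = count P R.
Proof. by rewrite -sumn_count sumnE big_map. Qed.

Section RankSets.
Variables m n : nat.
Hypotheses (m_gt0 : 0 < m) (n_gt0 : 0 < n) (co_mn : coprime m n).
Local Notation N := (m + n).

Let coN : coprime m N. Proof. by rewrite /coprime gcdnDl. Qed.
Let N_gt0 : 0 < N. Proof. lia. Qed.

Section Fixed.
Variable R : seq nat.
Hypothesis rR : rank_set m n R.

Let uR : uniq R. Proof. by case/and3P: rR. Qed.
Let sR : size R = N. Proof. by case/and3P: rR => _ /eqP. Qed.

Lemma rank_setP x : x \in R -> (x + m \in R) \/ (n <= x /\ x - n \in R).
Proof.
by case/and3P: rR => _ _ /allP h /h /orP[|/andP[]]; [left | right].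
Qed.

Lemma step_in x : x \in R -> step m n R x \in R.
Proof. by rewrite /step; case: ifP => // e /rank_setP[|[]]; rewrite ?e. Qed.

Lemma step_mod x : x \in R -> step m n R x = x + m %[mod N].
Proof.
rewrite /step; case: ifP => // e /rank_setP[|[nx _]]; first by rewrite e.
by rewrite -[in RHS](subnK nx) -addnA [n + m]addnC modnDr.
Qed.

Lemma iter_step_in k x : x \in R -> iter k (step m n R) x \in R.
Proof. by move=> xR; elim: k => //= k; apply: step_in. Qed.

Lemma iter_step_mod k x : x \in R -> iter k (step m n R) x = x + k * m %[mod N].
Proof.
move=> xR; elim: k => [|k ih]; first by rewrite addn0.
rewrite iterS step_mod ?iter_step_in // -modnDml ih modnDml mulSn.
by rewrite -addnA [k * m + m]addnC.
Qed.

(** Modulo [m + n] both kinds of step add [m], a generator, so the orbit of any element visits all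
    classes. As there are only [m + n] elements, each class is met once. *)
Lemma rank_set_onto j : exists2 x, x \in R & x = j %[mod N].
Proof.
case: R sR (iter_step_in) (iter_step_mod) => [|x S] s_S hin hmod.
  by move: s_S; rewrite /=; lia.
have [k ek] := orbit_mod x j m_gt0 N_gt0 coN.
by exists (iter k (step m n (x :: S)) x); rewrite ?hin ?hmod ?mem_head.
Qed.

Lemma rank_set_modI x y : x \in R -> y \in R -> x = y %[mod N] -> x = y.
Proof.
have u : uniq [seq x %% N | x <- R].
  apply: (@leq_size_uniq _ (iota 0 N)); rewrite ?iota_uniq //; last first.
    by rewrite size_map size_iota sR.
  move=> j; rewrite mem_iota add0n => /andP[_ jN].
  have [z zR ez] := rank_set_onto j; apply/mapP; exists z => //.
  by rewrite ez modn_small.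
move=> xR yR e; rewrite -(nth_index 0 xR) -(nth_index 0 yR); congr nth.
apply/eqP; rewrite -(nth_uniq 0 _ _ u) ?size_map ?index_mem //.
by rewrite !(nth_map 0) ?index_mem // !nth_index // e.
Qed.

Lemma step_down_notin x : x \in R -> x + m \in R -> n <= x -> x - n \notin R.
Proof.
move=> xR xm nx; apply/negP => xn.
suff : x + m = x - n by clear -m_gt0 nx; lia.
by apply: rank_set_modI => //; rewrite -[x in x + m](subnK nx) -addnA [n + m]addnC modnDr.
Qed.

Lemma perm_step : perm_eq [seq step m n R x | x <- R] R.
Proof.
have u : uniq [seq step m n R x | x <- R].
  rewrite map_inj_in_uniq // => x y xR yR e; apply: rank_set_modI => //.
  by apply/eqP; rewrite -(eqn_modDr m) -!step_mod // e.
have sub : {subset [seq step m n R x | x <- R] <= R}.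
  by move=> y /mapP[x xR ->]; apply: step_in.
have [|_ e] := uniq_min_size u sub; first by rewrite size_map.
exact: uniq_perm.
Qed.

Lemma rank_set_pred y : y \in R -> (m <= y /\ y - m \in R) \/ y + n \in R.
Proof.
rewrite -(perm_mem perm_step) => /mapP[x xR ->]; rewrite /step.
case: ifP => xm; first by left; rewrite addnK leq_addl.
by right; case: (rank_setP xR) => [|[nx _]]; [rewrite xm | rewrite subnK].
Qed.

(** [step] permutes R, so the sum of the elements is preserved and the climbs by [m] balance the
    descents by [n]. With [m + n] steps in all, exactly [n] are climbs. *)
Lemma count_step_up : count (fun x => x + m \in R) R = n.
Proof.
have e : \sum_(x <- R) step m n R x = \sum_(x <- R) x.
  by rewrite -[RHS](perm_big _ perm_step) /= big_map.
have : \sum_(x <- R) (step m n R x + n * ~~ (x + m \in R))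
     = \sum_(x <- R) (x + m * (x + m \in R)).
  apply: eq_big_seq => x xR; rewrite /step.
  case: ifP => xm; first by rewrite /= muln0 muln1 addn0.
  case: (rank_setP xR) => [|[nx _]]; first by rewrite xm.
  by rewrite muln1 muln0 addn0 subnK.
rewrite !big_split /= e => /eqP; rewrite eqn_add2l -!big_distrr /=.
rewrite !sum_count => /eqP.
have := count_predC (fun x => x + m \in R) R; rewrite sR.
set c := count _ _; set c' := count _ _; clear -m_gt0 n_gt0; nia.
Qed.

Lemma aboveP j :
  reflect (exists2 e, e \in R & e <= j /\ e = j %[mod N]) (above m n R j).
Proof.
apply: (iffP hasP) => [[e eR /andP[ej /eqP em]]|[e eR [ej em]]]; exists e => //.
by rewrite ej em eqxx.
Qed.

Lemma above_self j : j \in R -> above m n R j.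
Proof. by move=> jR; apply/aboveP; exists j. Qed.

Lemma above_m j : above m n R j -> above m n R (j + m).
Proof.
move=> /aboveP[e eR [ej em]]; apply/aboveP; exists (step m n R e).
  exact: step_in.
rewrite step_mod // -modnDml em modnDml; split=> //.
by rewrite /step; case: ifP => _; lia.
Qed.

Lemma above_n j : above m n R j -> above m n R (j + n).
Proof.
move=> /aboveP[e eR [ej em]]; apply/aboveP.
case: (rank_set_pred eR) => [[me eR']|eR'].
  exists (e - m) => //; split; first by clear -ej; lia.
  apply/eqP; rewrite -(eqn_modDr m) subnK // -addnA [n + m]addnC modnDr em.
  exact/eqP.
by exists (e + n) => //; split; [rewrite leq_add2r | rewrite -modnDml em modnDml].
Qed.

Lemma above_N j : above m n R j -> above m n R (j + N).
Proof. by rewrite addnA => /above_m/above_n. Qed.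

Lemma above_le j x : x \in R -> x = j %[mod N] -> above m n R j -> x <= j.
Proof.
move=> xR xj /aboveP[e eR [ej em]]; suff <- : e = x by [].
by apply: rank_set_modI => //; rewrite em.
Qed.

Lemma above_recN j :
  above m n R j = ((N <= j) && above m n R (j - N)) + (j \in R) :> nat.
Proof.
case: (boolP (j \in R)) => jR.
  rewrite above_self //; case: (leqP N j) => //= Nj.
  case: (boolP (above m n R (j - N))) => // h.
  have := above_le jR _ h; rewrite -{1}(subnK Nj) modnDr => /(_ erefl).
  by clear -N_gt0 Nj; lia.
rewrite addn0; congr nat_of_bool; apply/idP/andP => [/aboveP[e eR [ej em]]|[Nj]].
  have [k ek] : exists k, j = e + k * N.
    move/eqP: em; rewrite eq_sym eqn_mod_dvd // => /dvdnP[k ek].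
    by exists k; rewrite -ek subnKC.
  case: k ek => [|k ek]; first by rewrite addn0 => ek; rewrite ek eR in jR.
  split; first by rewrite ek; clear; lia.
  apply/aboveP; exists e => //; rewrite ek mulSn addnCA addKn; split.
    by rewrite leq_addr.
  by rewrite [e + _]addnC modnMDl.
by rewrite -{2}(subnK Nj); apply: above_N.
Qed.

(** [j - n] lies in the class that [step] reaches from the class of [j]. A step down lowers the
    representative by [n] too, so the two conditions agree. A step up delays the second one by
    exactly one turn [m + n], and they differ only when [j] is the representative itself. *)
Lemma above_recn j :
  above m n R j
    = ((n <= j) && above m n R (j - n)) + ((j + m \in R) && (j \in R)) :> nat.
Proof.
case: (boolP (_ && (j \in R))) => [/andP[jm jR]|njR].
  rewrite above_self //; case: (leqP n j) => //= nj.
  case: (boolP (above m n R (j - n))) => // h.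
  have := above_le jm _ h; rewrite -{1}(subnK nj) -addnA [n + m]addnC modnDr.
  by move=> /(_ erefl); clear -m_gt0 n_gt0 nj; lia.
rewrite addn0; congr nat_of_bool; apply/idP/andP => [/aboveP[e eR [ej em]]|[nj]].
  case: (rank_setP eR) => [em_R|[ne eR']]; last first.
    split; first exact: leq_trans ej.
    apply/aboveP; exists (e - n) => //; split; first by rewrite leq_sub2r.
    by apply/eqP; rewrite -(eqn_modDr n) !subnK ?em ?(leq_trans ne).
  have lt : e < j.
    rewrite ltn_neqAle ej andbT; apply: contraNneq njR => <-.
    by rewrite em_R eR.
  have Nje : N <= j - e.
    apply: dvdn_leq; first by rewrite subn_gt0.
    by rewrite -eqn_mod_dvd // em.
  have nj : n <= j by clear -Nje; lia.
  split=> //; apply/aboveP; exists (e + m) => //; split; first by clear -Nje ej; lia.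
  by apply/eqP; rewrite -(eqn_modDr n) subnK // -addnA modnDr em.
by rewrite -{2}(subnK nj); apply: above_n.
Qed.

Lemma profS j : prof m n R j.+1 = prof m n R j + above m n R j.
Proof. by rewrite /prof -addn1 iotaD count_cat /= addn0. Qed.

Lemma prof_recN j : prof m n R j = prof m n R (j - N) + count (fun x => x < j) R.
Proof.
elim: j => [|j ih].
  by rewrite sub0n /prof /= add0n; apply/esym/eqP; rewrite -leqn0 leqNgt -has_count;
    apply/hasPn => x; rewrite ltn0.
have /= -> := count_ltnS xpredT j uR; rewrite profS ih above_recN.
case: (leqP N j) => Nj; first by rewrite subSn // profS /=; lia.
have -> : j.+1 - N = 0 by clear -Nj; lia.
have -> : j - N = 0 by clear -Nj; lia.
by rewrite /=; lia.
Qed.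

Lemma prof_recn j :
  prof m n R j
    = prof m n R (j - n) + count (fun x => (x + m \in R) && (x < j)) R.
Proof.
elim: j => [|j ih].
  rewrite sub0n /prof /= add0n; apply/esym/eqP; rewrite -leqn0 leqNgt -has_count.
  by apply/hasPn => x; rewrite ltn0 andbF.
rewrite count_ltnS // profS ih above_recn.
case: (leqP n j) => nj; first by rewrite subSn // profS /=; lia.
have -> : j.+1 - n = 0 by clear -nj; lia.
have -> : j - n = 0 by clear -nj; lia.
by rewrite /=; lia.
Qed.

Lemma ltn_profS j : (prof m n R j < prof m n R j.+1) = above m n R j.
Proof. by rewrite profS; case: (above _ _ _ _); rewrite ?addn1 ?addn0 ?ltnn ?leqnn. Qed.

Lemma prof_lip : lip (prof m n R).
Proof. by move=> j; rewrite profS; case: (above _ _ _ _) => /=; lia. Qed.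

Lemma mem_prof j : (j \in R) = above m n R j && ~~ ((N <= j) && above m n R (j - N)).
Proof. by have := above_recN j; case: (above _ _ _ j); case: (_ && _); case: (j \in R). Qed.

Lemma prof_defect : exists i0, forall i, i0 <= i -> prof m n R i + defect m n R = i.
Proof.
(* Along the multiples of [n] the recursion [prof_recn] telescopes: each of the [n] elements [x]
   with [x + m] in R is missed by the first [x %/ n] rounds and counted in all later ones. *)
have key k : prof m n R (k * n) + \sum_(x <- R | x + m \in R) minn k (x %/ n) = k * n.
  elim: k => [|k ih].
    by rewrite mul0n /prof /= add0n big1 // => x _; rewrite min0n.
  rewrite prof_recn mulSn addKn.
  have e : \sum_(x <- R | x + m \in R) minn k.+1 (x %/ n)
      + count (fun x => (x + m \in R) && (x < n + k * n)) R
    = \sum_(x <- R | x + m \in R) (minn k (x %/ n) + 1).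
    rewrite -sum1_count big_mkcondr -big_split /=.
    apply: eq_bigr => x _; rewrite -mulSn -ltn_divLR // ltnS.
    by case: leqP; lia.
  rewrite -addnA [count _ _ + _]addnC e big_split /= sum1_count count_step_up.
  by rewrite addnA ih addnC.
(* At [B.+1 * n] every minimum in [key] is [x %/ n]; beyond it every level is above R, and both
   sides grow in step. *)
pose B := \max_(x <- R) x; exists (B.+1 * n) => i hi.
have le x : x \in R -> x <= B by move=> xR; apply: leq_bigmax_seq.
have /subnKC <- := hi; elim: (i - _) => [|j ih].
  rewrite addn0 -[RHS]key; congr (_ + _); rewrite /defect big_seq_cond [RHS]big_seq_cond.
  apply: eq_bigr => x /andP[/le xB _]; apply/esym/minn_idPr.
  by apply: leq_trans (leq_div _ _) _; apply: leqW.
rewrite addnS profS addnAC ih; set t := _ + j.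
suff -> : above m n R t by rewrite addn1.
have [e eR em] := rank_set_onto t; apply/aboveP; exists e => //; split=> //.
apply: leq_trans (le _ eR) _; rewrite /t; clear -n_gt0; nia.
Qed.
End Fixed.

Lemma flipK M R : {in R, forall x, x <= M} -> flip M (flip M R) = R.
Proof.
move=> le; rewrite /flip -map_comp -[RHS]map_id.
by apply/eq_in_map => x /le xM /=; rewrite subKn.
Qed.

Lemma mem_flip M R x : {in R, forall x, x <= M} -> x <= M ->
  (M - x \in flip M R) = (x \in R).
Proof.
move=> le xM; apply/mapP/idP => [[y yR e]|xR]; last by exists x.
by have := le _ yR => yM; suff -> : x = y by []; clear -xM yM e; lia.
Qed.

Lemma rank_set_flip M R : rank_set m n R -> {in R, forall x, x <= M} ->
  rank_set m n (flip M R).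
Proof.
move=> rR le; have /and3P[uR sR _] := rR; apply/and3P; split.
- rewrite map_inj_in_uniq // => x y /le xM /le yM e; clear -xM yM e; lia.
- by rewrite size_map.
apply/allP => _ /mapP[y yR ->]; have yM := le _ yR; apply/orP.
case: (rank_set_pred rR yR) => [[my yR']|yR'].
  left; rewrite (_ : _ + m = M - (y - m)); last by clear -my yM; lia.
  by rewrite mem_flip // le.
have := le _ yR' => ynM; right; apply/andP; split; first by clear -ynM; lia.
by rewrite -subnDA mem_flip.
Qed.

(** * The word of a rank set and the equation of its profile *)

Definition labels (r : seq nat) : word := [seq x + m \in r | x <- r].

Definition tails (w : word) (q : nat) := count_mem true (drop (size w - q) w).

Lemma tails_lip w : lip (tails w).
Proof.
move=> q; rewrite /tails; case: (ltnP q (size w)) => qw; last first.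
  have -> : size w - q.+1 = 0 by clear -qw; lia.
  have -> : size w - q = 0 by clear -qw; lia.
  by rewrite leqnn leqnSn.
rewrite -{1 2}(@prednK (size w - q)) ?subn_gt0 // -subnS.
set i := size w - q.+1; have iw : i < size w by rewrite /i; clear -qw; lia.
by rewrite [drop i w](drop_nth true) //=; case: (nth _ _ _) => /=; lia.
Qed.

Lemma drop_up (P : pred nat) r : sorted ltn r ->
  (forall x y, x <= y -> P x -> P y) ->
  drop (size r - count P r) r = filter P r.
Proof.
move=> sr up; elim: r sr => [|x r ih] //= sr; have {ih} := ih (path_sorted sr).
case Px: (P x) => ih /=.
  have /eqP -> : count P r == size r.
    rewrite -all_count; apply/allP => y yr; apply: up Px.
    by have /allP/(_ y yr)/ltnW := order_path_min ltn_trans sr.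
  by rewrite add1n subnn drop0; congr cons; apply/esym/all_filterP/allP => y yr;
    apply: up Px; have /allP/(_ y yr)/ltnW := order_path_min ltn_trans sr.
by rewrite add0n subSn ?count_size //= ih.
Qed.

Lemma take_down (P : pred nat) r : sorted ltn r ->
  (forall x y, x <= y -> P y -> P x) -> take (count P r) r = filter P r.
Proof.
move=> sr down; elim: r sr => [|x r ih] //= sr; have {ih} := ih (path_sorted sr).
case Px: (P x) => ih /=; first by rewrite ih.
suff e : count P r = 0 by rewrite -ih e add0n !take0.
apply/eqP; rewrite -leqn0 leqNgt -has_count; apply/hasPn => y yr.
apply: contraFN Px; apply: down.
by have /allP/(_ y yr)/ltnW := order_path_min ltn_trans sr.
Qed.

(** Complementation reverses the path: the points of the complement with [x + m] in it are
    [M - (y + m)] for the starts [y] of u steps. For them [x < q] means [M - y < q + m], so these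
    [y] are the S in a final stretch of [r], whose length is given by [prof_recN] at [q + m]. *)
Lemma profile_flip M r : rank_set m n r -> sorted ltn r ->
  {in r, forall x, x <= M} -> profile m n (tails (labels r)) (prof m n (flip M r)).
Proof.
move=> rr sr le; have rE := rank_set_flip rr le; have /and3P[ur _ _] := rr.
split=> [//||||q].
- exact: prof_lip.
- by move=> i; rewrite !ltn_profS //; apply: above_m.
- by move=> i; rewrite !ltn_profS //; apply: above_N.
rewrite [LHS]prof_recn // [prof m n _ (q + m)]prof_recN //.
rewrite (_ : q + m - N = q - n); last by clear; lia.
rewrite addKn; congr (_ + _).
have e : count (fun x => x < q + m) (flip M r) = count (fun x => M - x < q + m) r.
  by rewrite count_map.
rewrite e /tails /labels size_map -map_drop drop_up //; last first.
  by move=> x y xy; apply: leq_ltn_trans; rewrite leq_sub2l.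
rewrite [RHS]count_map [RHS]count_filter.
have p : perm_eq [seq x <- flip M r | x + m \in flip M r]
                 [seq M - (y + m) | y <- [seq y <- r | y + m \in r]].
  have /and3P[uE _ _] := rE.
  apply: uniq_perm; first exact: filter_uniq.
    rewrite map_inj_in_uniq ?filter_uniq // => x y; rewrite !mem_filter.
    by move=> /andP[/le xM _] /andP[/le yM _] e'; clear -xM yM e'; lia.
  move=> z; rewrite mem_filter; apply/andP/mapP => [[zm /mapP[y yr ez]]|[y]].
    have /mapP[x xr ex] := zm; have yM := le _ yr; have xM := le _ xr.
    have ey : y = x + m by clear -ez ex yM xM; lia.
    by exists x; rewrite ?mem_filter -?ey ?yr.
  rewrite mem_filter => /andP[ym yr ->]; have yM := le _ ym.
  rewrite mem_flip // (_ : _ + m = M - y) ?mem_flip ?(le _ yr) //.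
  by clear -yM; lia.
rewrite [LHS](_ : _ = count (fun x => x < q) [seq x <- flip M r | x + m \in flip M r]).
  2: by rewrite count_filter; apply: eq_count => x /=; rewrite andbC.
rewrite (permP p) count_map count_filter.
apply: eq_in_count => y yr /=; rewrite andbC.
case: (boolP (y + m \in r)) => //= ym; have yM := le _ ym.
by apply/idP/idP; clear -yM; lia.
Qed.

Definition rank_seq (r : seq nat) :=
  [&& rank_set m n r, sorted ltn r & 0 \in r].

(* The area of the rank complement. *)
Definition codefect (r : seq nat) := defect m n (flip (last 0 r) r).

Lemma sorted_le_last r : sorted ltn r -> {in r, forall x, x <= last 0 r}.
Proof.
case/lastP: r => [//|r x]; rewrite last_rcons (sorted_pairwise ltn_trans).
rewrite pairwise_rcons => /andP[/allP lt _] y.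
by rewrite mem_rcons in_cons => /orP[/eqP -> //|/lt/ltnW].
Qed.

Lemma flip_last1 r : rank_seq r -> prof m n (flip (last 0 r) r) 1 = 1.
Proof.
move=> /and3P[rr sr r0]; have le := sorted_le_last sr.
rewrite profS ?rank_set_flip // /prof /= above_self ?rank_set_flip //.
suff : last 0 r - last 0 r \in flip (last 0 r) r by rewrite subnn.
by rewrite mem_flip //; case: r r0 {rr sr le} => // x r _; apply: mem_last.
Qed.

Lemma codefect_le r1 r2 : rank_seq r1 -> rank_seq r2 ->
  (forall q, tails (labels r1) q <= tails (labels r2) q) ->
  codefect r1 <= codefect r2.
Proof.
move=> h1 h2 T12; have /and3P[rr1 sr1 _] := h1; have /and3P[rr2 sr2 _] := h2.
have [i1 d1] := prof_defect (rank_set_flip rr1 (sorted_le_last sr1)).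
have [i2 d2] := prof_defect (rank_set_flip rr2 (sorted_le_last sr2)).
apply: (@profile_defect_le m n (maxn i1 i2) _ _ (tails (labels r1)) (tails (labels r2))
  (prof m n (flip (last 0 r1) r1)) (prof m n (flip (last 0 r2) r2))) => //.
- exact: tails_lip.
- exact: tails_lip.
- exact: profile_flip (sorted_le_last sr1).
- exact: profile_flip (sorted_le_last sr2).
- by move=> i; rewrite geq_max => /andP[/d1].
- by move=> i; rewrite geq_max => /andP[_ /d2].
exact: flip_last1.
Qed.

(** [codefect_le] in both directions makes the codefects equal, so the two profiles coincide far
    away. This is the hypothesis that lets [profile_le] apply in both directions. *)
Lemma labels_inj r1 r2 : rank_seq r1 -> rank_seq r2 -> labels r1 = labels r2 -> r1 = r2.
Proof.
move=> h1 h2 e12.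
have ed : codefect r1 = codefect r2.
  by apply/eqP; rewrite eqn_leq !codefect_le // e12.
have le s1 s2 : rank_seq s1 -> rank_seq s2 -> labels s1 = labels s2 ->
    codefect s1 = codefect s2 -> forall i,
    prof m n (flip (last 0 s1) s1) i <= prof m n (flip (last 0 s2) s2) i.
  move=> /and3P[rr1 sr1 _] /and3P[rr2 sr2 _] es ecd.
  have [i1 d1] := prof_defect (rank_set_flip rr1 (sorted_le_last sr1)).
  have [i2 d2] := prof_defect (rank_set_flip rr2 (sorted_le_last sr2)).
  apply: (@profile_le m n (maxn i1 i2) (tails (labels s1)) (tails (labels s2))) => //.
  - exact: tails_lip.
  - exact: tails_lip.
  - by rewrite es.
  - exact: profile_flip (sorted_le_last sr1).
  - exact: profile_flip (sorted_le_last sr2).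
  move=> i; rewrite geq_max => /andP[/d1 e1 /d2 e2].
  by rewrite -(leq_add2r (codefect s1)) {2}ecd e1 e2.
have {le ed} ep i : prof m n (flip (last 0 r1) r1) i = prof m n (flip (last 0 r2) r2) i.
  by apply/eqP; rewrite eqn_leq !le.
have /and3P[rr1 sr1 z1] := h1; have /and3P[rr2 sr2 z2] := h2.
have rf1 := rank_set_flip rr1 (sorted_le_last sr1).
have rf2 := rank_set_flip rr2 (sorted_le_last sr2).
have em : flip (last 0 r1) r1 =i flip (last 0 r2) r2.
  move=> j; rewrite !mem_prof // -!ltn_profS //.
  by rewrite !ep.
(* As 0 is a rank, the maximum belongs to its own complement, and no element of the other complement
   exceeds the other maximum. *)
have lastE s1 s2 : sorted ltn s1 -> 0 \in s1 -> sorted ltn s2 ->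
    flip (last 0 s1) s1 =i flip (last 0 s2) s2 -> last 0 s1 <= last 0 s2.
  move=> ss1 zs1 ss2 e; have /mapP[y _ ->] : last 0 s1 \in flip (last 0 s2) s2.
    by rewrite -e -[X in X \in _]subn0 mem_flip //; apply: sorted_le_last.
  by rewrite leq_subr.
have el : last 0 r1 = last 0 r2.
  apply/eqP; rewrite eqn_leq !lastE // => j; exact/esym/em.
apply: (irr_sorted_eq ltn_trans ltnn) => // x.
rewrite -(flipK (sorted_le_last sr1)) -(flipK (sorted_le_last sr2)) el.
move: em; rewrite el => em; apply/mapP/mapP => [][y yr ->]; exists y => //.
  by rewrite -em.
by rewrite em.
Qed.

End RankSets.

(** * Words and compatible sequences *)

Lemma ltn_nth_sorted (s : seq nat) (d i j : nat) : sorted ltn s -> i <= d ->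
  (nth d s j < i) = (j < count (fun x => x < i) s).
Proof.
move=> + id; elim: s j => [|x s ih] j ss /=; first by rewrite nth_nil ltnNge id.
have /allP lt := order_path_min ltn_trans ss.
case: (ltnP x i) => xi.
  by case: j => [|j] /=; rewrite ?xi // ih // (path_sorted ss).
have c0 : count (fun y => y < i) s = 0.
  apply/eqP; rewrite -leqn0 leqNgt -has_count; apply/hasPn => y /lt xy.
  by rewrite -leqNgt (leq_trans xi) // ltnW.
by rewrite c0; case: j => [|j] /=; rewrite ?ih ?(path_sorted ss) // ?c0 // ltnNge xi.
Qed.

Section Positions.
Variables (b : bool) (w : word).

(** An adjunction between positions and prefix counts: it turns comparisons of positions into
    comparisons of numbers of letters. *)
Lemma posP (i j : nat) : 0 < j -> i <= size w ->
  (pos b j w <= i) = (j <= count_mem b (take i w)).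
Proof.
case: j => // j _ iw; rewrite /pos /= ltn_nth_sorted ?iw //; last first.
  by apply: sorted_filter; [apply: ltn_trans | apply: iota_ltn_sorted].
congr (_ < _); rewrite count_filter -(subnKC iw) iotaD count_cat add0n.
rewrite [X in _ + X](_ : _ = 0) ?addn0; last first.
  apply/eqP; rewrite -leqn0 leqNgt -has_count; apply/hasPn => k.
  by rewrite mem_iota => /andP[ik _] /=; rewrite ltnNge ik.
rewrite -[in RHS](mkseq_nth (~~ b) w) /mkseq -map_take take_iota (minn_idPl iw).
rewrite count_map; apply: eq_in_count => k.
by rewrite mem_iota => /andP[_ ki] /=; rewrite ki.
Qed.

Lemma pos_le_size j : pos b j w <= (size w).+1.
Proof.
rewrite /pos ltnS; set s := filter _ _; case: (ltnP j.-1 (size s)) => js.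
  by have := mem_nth (size w) js; rewrite mem_filter mem_iota => /andP[_ /andP[_ /ltnW]].
by rewrite nth_default.
Qed.

Lemma nth_pos j x0 : pos b j w <= size w -> nth x0 w (pos b j w).-1 = b.
Proof.
rewrite /pos /=; set s := filter _ _; case: (ltnP j.-1 (size s)) => js lt.
  have := mem_nth (size w) js; rewrite mem_filter => /andP[/eqP h _].
  by rewrite -[RHS]h; apply: set_nth_default.
by rewrite nth_default // ltnn in lt.
Qed.

Lemma pos_eq (p : nat) : p < size w -> nth (~~ b) w p = b ->
  pos b (count_mem b (take p.+1 w)) w = p.+1.
Proof.
move=> pw e; have ct : count_mem b (take p.+1 w) = (count_mem b (take p w)).+1.
  by rewrite (take_nth (~~ b) pw) -cats1 count_cat /= e eqxx addn0 addn1.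
rewrite ct; apply/eqP; rewrite eqn_leq posP // ct leqnn /= ltnNge.
by rewrite posP ?ltnn // ltnW.
Qed.

End Positions.

Lemma count_take_mono (b : bool) (w : word) (i j : nat) : i <= j ->
  count_mem b (take i w) <= count_mem b (take j w).
Proof.
by move=> ij; rewrite -(subnKC ij) takeD count_cat leq_addr.
Qed.

Lemma count_mem_bool (w : word) : count_mem true w + count_mem false w = size w.
Proof.
rewrite -(count_predC (pred1 true)); congr (_ + _).
by apply: eq_count => -[].
Qed.

Section Words.
Variables m n : nat.
Hypotheses (m_gt0 : 0 < m) (n_gt0 : 0 < n) (co_mn : coprime m n).
Local Notation N := (m + n).
Local Notation rank_seq := (rank_seq m n).
Local Notation labels := (labels m).

Lemma rank_seq_size r : rank_seq r -> size r = N.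
Proof. by case/and3P => /and3P[_ /eqP]. Qed.

Lemma size_labels r : size (labels r) = size r.
Proof. by rewrite size_map. Qed.

Lemma count_labels (b : bool) (r : seq nat) :
  count_mem b (labels r) = count (fun x => (x + m \in r) == b) r.
Proof. by rewrite count_map. Qed.

Lemma count_true_labels r : rank_seq r -> count_mem true (labels r) = n.
Proof.
move=> /and3P[rr _ _]; rewrite count_labels -(count_step_up _ _ _ rr) //.
by apply: eq_count => x; rewrite eqb_id.
Qed.

Lemma count_false_labels r : rank_seq r -> count_mem false (labels r) = m.
Proof.
move=> rr; have := count_mem_bool (labels r).
rewrite count_true_labels // size_labels rank_seq_size // [m + n]addnC.
by move/addnI.
Qed.

(** Every position carries some S_i or W_j, so compatibility prescribes a step at each rank. A
    letter W excludes [x + m] from [r], because [x + m] and [x - n] share a class modulo [m + n]. *)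
Lemma compatibleE (w : word) (r : seq nat) :
  count_mem true w = n -> count_mem false w = m ->
  compatible m n w r = rank_seq r && (w == labels r).
Proof.
move=> ct cf; have sw_ : size w = N by rewrite -count_mem_bool ct cf addnC.
apply/idP/idP.
  case/and5P => /eqP sr srt r0 /allP hS /allP hW.
  have cnt b p : p < N -> nth (~~ b) w p = b ->
      0 < count_mem b (take p.+1 w) <= count_mem b w.
    move=> pN e; apply/andP; split.
      by rewrite (take_nth (~~ b)) ?sw_ // -cats1 count_cat /= e eqxx addn0 addn1.
    by rewrite -{2}[w]take_size count_take_mono ?sw_.
  have up p : p < N -> nth false w p -> nth 0 r p + m \in r.
    move=> pN wp; have /= := hS (count_mem true (take p.+1 w)).
    rewrite pos_eq ?sw_ //; apply; rewrite mem_iota add1n ltnS -ct.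
    exact: (cnt true p pN wp).
  have down p : p < N -> nth true w p = false ->
      (n <= nth 0 r p) && (nth 0 r p - n \in r).
    move=> pN wp; have /= := hW (count_mem false (take p.+1 w)).
    rewrite pos_eq ?sw_ //; apply; rewrite mem_iota add1n ltnS -cf.
    exact: (cnt false p pN wp).
  have rr : rank_set m n r.
    apply/and3P; split; [exact: (sorted_uniq ltn_trans ltnn) | exact/eqP |].
    apply/(all_nthP 0) => p; rewrite sr => pN.
    case: (boolP (nth false w p)) => wp; first by rewrite up.
    rewrite down ?orbT //; apply/negbTE.
    by rewrite (set_nth_default false) ?sw_.
  rewrite /rank_seq rr srt r0 /=; apply/eqP.
  apply: (@eq_from_nth _ false) => [|p]; rewrite ?size_labels ?sr //.
  rewrite sw_ => pN; rewrite (nth_map 0) ?sr //.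
  case: (boolP (nth false w p)) => wp; first by rewrite up.
  have /andP[nx xn] : (n <= nth 0 r p) && (nth 0 r p - n \in r).
    by apply: down => //; rewrite (set_nth_default false) ?sw_ //; apply/negbTE.
  apply/esym/negbTE/negP => h.
  by have := step_down_notin m_gt0 n_gt0 co_mn rr _ h nx; rewrite xn mem_nth ?sr // => /(_ isT).
move=> /andP[rr /eqP ew]; have /and3P[rs srt r0] := rr.
have sr := rank_seq_size rr.
have letter b i : 0 < i <= count_mem b w ->
    pos b i w <= N /\ nth (~~ b) w (pos b i w).-1 = b.
  move=> /andP[i0 ib]; have le : pos b i w <= size w.
    by rewrite posP // take_size.
  by split; [rewrite -sw_ | rewrite nth_pos].
apply/and5P; split=> //; first exact/eqP.
  apply/allP => i; rewrite mem_iota add1n ltnS -ct => /letter[].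
  rewrite /term; set p := (pos _ _ _).-1 => pN e.
  have pN' : p < size r by rewrite sr /p prednK.
  by move: e; rewrite ew (nth_map 0) //= => ->.
apply/allP => i; rewrite mem_iota add1n ltnS -cf => /letter[].
rewrite /term; lazy zeta; set p := (pos _ _ _).-1 => pN e.
have pN' : p < size r by rewrite sr /p prednK.
move: e; rewrite ew (nth_map 0) //= => e.
have := rank_setP rs (mem_nth 0 pN'); rewrite e => -[//|[-> ->]//].
Qed.

End Words.

(** * Dyck paths *)

Section Dyck.
Variables m n : nat.
Hypotheses (m_gt0 : 0 < m) (n_gt0 : 0 < n) (co_mn : coprime m n).
Local Notation N := (m + n).
Local Notation rank_set := (rank_set m n).
Local Notation rank_seq := (rank_seq m n).
Local Notation labels := (labels m).
Local Notation is_dyck := (is_dyck m n).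
Local Notation pr := (point_rank m n).

Lemma dyckE (w : word) : is_dyck w ->
  [/\ count_mem true w = n, count_mem false w = m, size w = N &
    forall i, n * count_mem false (take i w) <= m * count_mem true (take i w)].
Proof.
case/and3P => /eqP ct /eqP cf /allP h; have s : size w = N.
  by rewrite -count_mem_bool ct cf addnC.
split=> // i; case: (leqP i (size w)) => iw; first by apply: h; rewrite mem_iota.
by rewrite take_oversize ?(ltnW iw) // ct cf mulnC.
Qed.

Lemma dyckI (w : word) : count_mem true w = n -> count_mem false w = m ->
  (forall i, i <= N ->
    n * count_mem false (take i w) <= m * count_mem true (take i w)) ->
  is_dyck w.
Proof.
move=> ct cf h; rewrite /Defs.is_dyck ct cf; apply/and3P; split=> //; apply/allP => i.
rewrite mem_iota add0n ltnS => iw; apply: h.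
by move: iw; rewrite -count_mem_bool ct cf addnC.
Qed.

Lemma rank_set_perm R1 R2 : perm_eq R1 R2 -> rank_set R1 = rank_set R2.
Proof.
move=> p; rewrite /rank_set (perm_uniq p) (perm_size p); congr [&& _, _ & _].
rewrite (perm_all _ p); apply: eq_all => x.
by rewrite !(perm_mem p).
Qed.

Section OneWord.
Variable D : word.
Hypothesis dD : is_dyck D.

Let sD : size D = N. Proof. by case/dyckE: dD. Qed.

Lemma point_rankE i : pr D i + n * count_mem false (take i D) = m * count_mem true (take i D).
Proof. by rewrite /point_rank subnK //; case/dyckE: dD. Qed.

Lemma point_rank0 : pr D 0 = 0.
Proof. by rewrite /point_rank take0 !muln0. Qed.

Lemma point_rankN : pr D N = 0.
Proof.
have [ct cf _ _] := dyckE dD.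
by rewrite /point_rank -sD take_size ct cf [n * m]mulnC subnn.
Qed.

Lemma point_rankS i : i < N ->
  pr D i.+1 + (if nth false D i then 0 else n)
    = pr D i + (if nth false D i then m else 0).
Proof.
move=> iN; have := point_rankE i.+1; have := point_rankE i.
rewrite (take_nth false) ?sD // -cats1 !count_cat /=.
by case: (nth false D i) => /=; lia.
Qed.

Lemma point_rank_mod i : i <= N -> pr D i = i * m %[mod N].
Proof.
move=> iN; have e := point_rankE i.
have s : count_mem true (take i D) + count_mem false (take i D) = i.
  by rewrite count_mem_bool size_take sD; case: ltngtP iN.
have -> : i * m = count_mem false (take i D) * N + pr D i.
  by rewrite -[in LHS]s mulnDl [_ * m]mulnC -e; lia.
by rewrite modnMDl.
Qed.

Lemma point_rank_in i : i <= N -> pr D i \in ranks m n D.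
Proof.
rewrite leq_eqVlt => /orP[/eqP ->|iN].
  rewrite point_rankN -point_rank0; apply: map_f; rewrite mem_iota; lia.
by apply: map_f; rewrite mem_iota.
Qed.

Lemma size_ranks : size (ranks m n D) = N.
Proof. by rewrite size_map size_iota. Qed.

Lemma nth_ranks x0 i : i < N -> nth x0 (ranks m n D) i = pr D i.
Proof. by move=> iN; rewrite (nth_map 0) ?size_iota ?nth_iota. Qed.

Lemma uniq_ranks : uniq (ranks m n D).
Proof.
rewrite map_inj_in_uniq ?iota_uniq // => i j; rewrite !mem_iota /= !add0n => iN jN e.
have := point_rank_mod (ltnW iN); rewrite e (point_rank_mod (ltnW jN)) => /eqP.
have co : coprime N m by rewrite /coprime gcdnC gcdnDl -/(coprime _ _).
wlog ij : i j iN jN {e} / i <= j.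
  move=> H; case: (leqP i j) => ij; first exact: H.
  by rewrite eq_sym => e'; apply/esym/H => //; apply: ltnW.
rewrite eqn_mod_dvd ?leq_mul2r ?ij ?orbT // -mulnBl Gauss_dvdl // => dv.
case: (posnP (j - i)) => [|ji]; first by clear -ij; lia.
by have := dvdn_leq ji dv; clear -iN jN; lia.
Qed.

Lemma ranks_rank_set : rank_set (ranks m n D).
Proof.
apply/and3P; split; [exact: uniq_ranks | by rewrite size_ranks |].
apply/allP => x /mapP[i]; rewrite mem_iota add0n /= => iN ->.
have := point_rankS iN; have := point_rank_in iN; case: (nth _ _ _) => pin e.
  by rewrite -[_ + m]e addn0 pin.
move: e; rewrite addn0 => <-.
by rewrite addnK pin leq_addl orbT.
Qed.

Lemma ranks0 : 0 \in ranks m n D.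
Proof. by rewrite -point_rank0; apply: point_rank_in. Qed.

Lemma nth_dyck i : i < N -> nth false D i = (pr D i + m \in ranks m n D).
Proof.
move=> iN; have := point_rankS iN; have pin := point_rank_in iN.
case: (nth _ _ _) => e; first by rewrite -[_ + m]e addn0 pin.
apply/esym/negbTE/negP => h; move: e; rewrite addn0 => e.
have := step_down_notin m_gt0 n_gt0 co_mn ranks_rank_set (point_rank_in (ltnW iN)) h.
by rewrite -e addnK leq_addl pin => /(_ isT).
Qed.

Lemma perm_sorted_ranks : perm_eq (sorted_ranks m n D) (ranks m n D).
Proof. by rewrite /sorted_ranks perm_sort. Qed.

Lemma sorted_ranks_rank_seq : rank_seq (sorted_ranks m n D).
Proof.
rewrite /rank_seq (rank_set_perm perm_sorted_ranks) ranks_rank_set.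
rewrite (perm_mem perm_sorted_ranks) ranks0 andbT /=.
by rewrite ltn_sorted_uniq_leq sort_uniq uniq_ranks sort_sorted //; apply: leq_total.
Qed.

Lemma sw_labels : sw m n D = labels (sorted_ranks m n D).
Proof.
apply/eq_in_map => x; rewrite mem_sort => xD.
have iN : index x (ranks m n D) < N by rewrite -size_ranks index_mem.
by rewrite nth_dyck // -(nth_ranks 0 iN) nth_index // (perm_mem perm_sorted_ranks).
Qed.

End OneWord.

(** The path follows [step] from 0. After [m + n] steps its rank is in the class of 0, hence equal
    to 0, and the balance of the rank then fixes the numbers of both letters. *)
Lemma dyck_of_rank_set R : rank_set R -> 0 \in R ->
  exists2 D, is_dyck D & perm_eq (ranks m n D) R.
Proof.
move=> rR R0; pose x k := iter k (step m n R) 0.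
have xR k : x k \in R by apply: iter_step_in.
pose D := [seq x k + m \in R | k <- iota 0 N].
have sD : size D = N by rewrite size_map size_iota.
have e k : k <= N -> x k + n * count_mem false (take k D) = m * count_mem true (take k D).
  elim: k => [|k ih] kN; first by rewrite take0 !muln0.
  have {ih} := ih (ltnW kN).
  rewrite (take_nth false) ?sD // -cats1 !count_cat (nth_map 0) ?size_iota //.
  rewrite nth_iota // add0n (_ : x k.+1 = step m n R (x k)) // /step /=.
  case: ifP => xm /=; first by lia.
  case: (rank_setP rR (xR k)) => [|[nx _]]; first by rewrite xm.
  by lia.
have xN : x N = 0.
  apply: (rank_set_modI m_gt0 n_gt0 co_mn rR) => //.
  by rewrite iter_step_mod // add0n mod0n mulnC modnMl.
have := e N (leqnn _); rewrite xN -sD take_size => eN.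
have := count_mem_bool D; rewrite sD => sum.
have ct : count_mem true D = n by clear -eN sum m_gt0 n_gt0; nia.
have cf : count_mem false D = m by clear -ct sum; lia.
have dD : is_dyck D.
  by apply: dyckI => // i iN; rewrite -e // leq_addl.
exists D => //; have prx i : i <= N -> pr D i = x i.
  by move=> iN; apply/eqP; rewrite -(eqn_add2r (n * count_mem false (take i D))) point_rankE // e.
have uR : uniq R by case/and3P: rR.
have sR : size R = N by case/and3P: rR => _ /eqP.
apply: uniq_perm => //; first exact: uniq_ranks.
have sub : {subset ranks m n D <= R}.
  by move=> y /mapP[i]; rewrite mem_iota add0n => /ltnW iN ->; rewrite prx.
by have [|_] := uniq_min_size (uniq_ranks dD) sub; rewrite // sR size_ranks.
Qed.

Lemma dyck_inj D1 D2 : is_dyck D1 -> is_dyck D2 ->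
  ranks m n D1 =i ranks m n D2 -> D1 = D2.
Proof.
move=> d1 d2 e; have [_ _ s1 _] := dyckE d1; have [_ _ s2 _] := dyckE d2.
have ep i : i <= N -> pr D1 i = pr D2 i.
  elim: i => [|i ih] iN; first by rewrite !point_rank0.
  have := point_rankS d1 iN; have := point_rankS d2 iN.
  rewrite !nth_dyck // (ih (ltnW iN)) -e; case: (_ \in _); lia.
apply: (@eq_from_nth _ false) => [|i]; rewrite s1 ?s2 // => iN.
by rewrite !nth_dyck // ep ?e // ltnW.
Qed.

Lemma dyck_of_rank_seq r : rank_seq r ->
  exists D, [/\ is_dyck D, sw m n D = labels r & sorted_ranks m n D = r].
Proof.
move=> rr; have /and3P[rs sr r0] := rr.
have [D dD p] := dyck_of_rank_set rs r0.
suff e : sorted_ranks m n D = r by exists D; rewrite sw_labels // e.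
apply: (irr_sorted_eq ltn_trans ltnn) => //.
  by have /and3P[] := sorted_ranks_rank_seq dD.
by move=> x; rewrite (perm_mem (perm_sorted_ranks D)) (perm_mem p).
Qed.

End Dyck.

Lemma count_interval (x y M : nat) : 
  count (fun a => (x <= a) && (a < y)) (iota 0 M) = minn y M - x.
Proof.
elim: M => [|M ih]; first by rewrite minn0.
rewrite -addn1 iotaD count_cat ih /= add0n addn0.
by case: (leqP x M); case: (leqP M.+1 y) => /=; lia.
Qed.

(** * The sweep map and the area *)

Section Sweep.
Variables m n : nat.
Hypotheses (m_gt0 : 0 < m) (n_gt0 : 0 < n) (co_mn : coprime m n).
Local Notation N := (m + n).
Local Notation rank_set := (rank_set m n).
Local Notation rank_seq := (rank_seq m n).
Local Notation labels := (labels m).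
Local Notation is_dyck := (is_dyck m n).
Local Notation pr := (point_rank m n).

(* Truncating the ranks at the level L of the i-th point turns the balance of
   the closed path into the Dyck inequality for the first i letters. *)
Lemma labels_dyck r : rank_seq r -> is_dyck (labels r).
Proof.
move=> rr; have /and3P[rs sr _] := rr; have sz := rank_seq_size rr.
have [ct cf] := (count_true_labels m_gt0 n_gt0 co_mn rr, count_false_labels m_gt0 n_gt0 co_mn rr).
apply: dyckI => // i; rewrite leq_eqVlt => /orP[/eqP ->|iN].
  by rewrite take_oversize ?size_labels ?sz // ct cf mulnC.
rewrite /labels -map_take !count_map; pose L := nth 0 r i.
have lo x : x \in take i r -> x < L.
  move=> xt; have := xt; rewrite -index_mem size_takel ?sz ?(ltnW iN) // => ji.
  rewrite -(nth_index 0 xt) nth_take // /L.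
  by apply: (sorted_ltn_nth ltn_trans) => //; rewrite inE sz // (ltn_trans ji).
have hi x : x \in drop i r -> L <= x.
  move=> xd; have ji := xd; rewrite -index_mem size_drop sz in ji.
  rewrite -(nth_index 0 xd) nth_drop /L; case: (posnP (index x (drop i r))) => [->|j0].
    by rewrite addn0.
  apply/ltnW/(sorted_ltn_nth ltn_trans) => //; rewrite ?inE ?sz //; lia.
have tot : \sum_(x <- r) minn (step m n r x) L = \sum_(x <- r) minn x L.
  by rewrite -[RHS](perm_big _ (perm_step m_gt0 n_gt0 co_mn rs)) /= big_map.
have h1 : \sum_(x <- take i r) (minn (step m n r x) L + n * ~~ (x + m \in r))
    <= \sum_(x <- take i r) (minn x L + m * (x + m \in r)).
  rewrite big_seq [leqRHS]big_seq; apply: leq_sum => x xt; have := lo x xt.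
  rewrite /step; case: (boolP (x + m \in r)) => /= xm; first by lia.
  case: (rank_setP rs (mem_take xt)) => [|[nx _]]; first by rewrite (negPf xm).
  lia.
have h2 : \sum_(x <- drop i r) minn (step m n r x) L
    <= \sum_(x <- drop i r) minn x L.
  rewrite big_seq [leqRHS]big_seq; apply: leq_sum => x /hi; lia.
have splitE F : \sum_(x <- r) F x = \sum_(x <- take i r) F x + \sum_(x <- drop i r) F x.
  by rewrite -{1}(cat_take_drop i r) big_cat.
move: tot h1 h2; rewrite !splitE !big_split /= -!big_distrr /= !sum_count.
move=> tot h1 h2.
set c1 := count _ _; set c2 := count _ _.
have -> : c1 = count (fun x => ~~ (x + m \in r)) (take i r).
  by apply: eq_count => x /=; rewrite eqbF_neg.
have -> : c2 = count (fun x => (x + m \in r)) (take i r).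
  by apply: eq_count => x /=; rewrite eqb_id.
move: tot h1 h2; set s1 := bigop.body _ _ _; set s2 := bigop.body _ _ _.
set s3 := bigop.body _ _ _; set s4 := bigop.body _ _ _.
by move: s1 s2 s3 s4 (n * _) (m * _) => *; lia.
Qed.

Lemma dyck_onto w : is_dyck w -> exists2 r, rank_seq r & labels r = w.
Proof.
pose all_dyck := [seq v <- [seq val t | t <- enum {: N.-tuple bool}] | is_dyck v].
have uD : uniq all_dyck.
  by rewrite filter_uniq // map_inj_uniq ?enum_uniq //; apply: val_inj.
have memD v : (v \in all_dyck) = is_dyck v.
  rewrite mem_filter andb_idr // => /dyckE[_ _ /eqP sv _].
  by apply/mapP; exists (Tuple sv); rewrite ?mem_enum.
have uS : uniq [seq sw m n v | v <- all_dyck].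
  rewrite map_inj_in_uniq // => v1 v2; rewrite !memD => d1 d2.
  rewrite !sw_labels // => /(labels_inj m_gt0 n_gt0 co_mn) e.
  apply: (dyck_inj m_gt0 n_gt0 co_mn) => // x.
  rewrite -(perm_mem (perm_sorted_ranks m n v1)) e ?(perm_mem (perm_sorted_ranks m n v2)) //.
    exact: sorted_ranks_rank_seq.
  exact: sorted_ranks_rank_seq.
have sub : {subset [seq sw m n v | v <- all_dyck] <= all_dyck}.
  move=> v /mapP[u]; rewrite memD => du ->; rewrite memD sw_labels //.
  exact/labels_dyck/sorted_ranks_rank_seq.
have [|_ e] := uniq_min_size uS sub; first by rewrite size_map.
rewrite -memD -e => /mapP[v]; rewrite memD => dv ->.
by exists (sorted_ranks m n v); [apply: sorted_ranks_rank_seq | rewrite sw_labels].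
Qed.

Lemma area_defect E : is_dyck E -> area m n E = defect m n (ranks m n E).
Proof.
move=> dE; have [ct cf sE _] := dyckE dE.
pose L := [seq i <- iota 0 (size E) | nth false E i == true].
have sL : size L = n.
  rewrite size_filter -[RHS]ct -[in RHS](mkseq_nth false E) /mkseq count_map.
  by apply: eq_count.
(* The cells of row [b] have abscissas from [c], that of the north step, to [m * b %/ n - 1], and
   [m * b - n * c] is the rank where this step starts. *)
have row b : b < n -> nth (size E) L b < N -> 
    \sum_(a <- iota 0 m) ((count_mem false (take (pos true b.+1 E) E) <= a) && (n * a.+1 <= m * b))
    = pr E (nth (size E) L b) %/ n.
  move=> bn; set p := nth _ _ _ => pN.
  have ep : pos true b.+1 E = p.+1 by [].
  have Ep : nth false E p by rewrite -[p]/(p.+1.-1) -ep nth_pos // ep sE.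
  have tk : take p.+1 E = rcons (take p E) true by rewrite (take_nth false) ?sE // Ep.
  have cb : count_mem true (take p E) = b.
    have := @posP true E p.+1 b.+1 isT; have := @posP true E p b.+1 isT.
    rewrite ep tk -cats1 count_cat /= sE => /(_ (ltnW pN)) h1 /(_ pN) h2.
    move: h1 h2; rewrite ltnn leqnn; set c := count_mem _ _; lia.
  rewrite ep tk -cats1 count_cat /= !addn0 sum_count.
  have := point_rankE dE p; rewrite cb; set c := count_mem false _ => epr.
  rewrite (eq_count (a2 := fun a => (c <= a) && (a < m * b %/ n))); last first.
    by move=> a; rewrite mulnC -leq_divRL.
  rewrite count_interval; have /minn_idPl -> : m * b %/ n <= m.
    by rewrite -[leqRHS](mulnK m n_gt0) leq_div2r // leq_mul2l ltnW ?orbT.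
  by rewrite -epr [n * c]mulnC addnC divnMDl // addKn.
rewrite /area -sum_count big_allpairs_dep /= exchange_big /=.
rewrite /defect /ranks big_map.
transitivity (\sum_(p <- L) pr E p %/ n).
  rewrite -[in RHS](mkseq_nth (size E) L) big_map sL.
  apply: eq_big_seq => b; rewrite mem_iota add0n => bn.
  apply: row => //; have : nth (size E) L b \in L by rewrite mem_nth ?sL.
  by rewrite mem_filter mem_iota add0n sE => /andP[].
rewrite big_filter sE big_seq_cond [RHS]big_seq_cond; apply: eq_bigl => i.
rewrite mem_iota add0n; case: (ltnP i N) => //= iN.
by rewrite eqb_id (nth_dyck m_gt0 n_gt0 co_mn).
Qed.

Lemma defect_perm R1 R2 : perm_eq R1 R2 -> defect m n R1 = defect m n R2.
Proof.
by move=> p; rewrite /defect (perm_big _ p); apply: eq_bigl => x; rewrite (perm_mem p).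
Qed.

Lemma max_ranks D : is_dyck D ->
  \max_(y <- ranks m n D) y = last 0 (sorted_ranks m n D).
Proof.
move=> dD; have /and3P[_ srt r0] := sorted_ranks_rank_seq m_gt0 n_gt0 co_mn dD.
rewrite -(perm_big _ (perm_sorted_ranks m n D)); apply/eqP.
rewrite eqn_leq; apply/andP; split.
  by apply/bigmax_leqP_seq => x xr _; apply: sorted_le_last.
by apply: leq_bigmax_seq => //; case: (sorted_ranks _ _ _) r0 => // x s _; apply: mem_last.
Qed.

Lemma rank_complement_exists D : is_dyck D ->
  exists2 E, is_rank_complement m n D E &
    area m n E = codefect m n (sorted_ranks m n D).
Proof.
move=> dD; have /and3P[rs srt r0] := sorted_ranks_rank_seq m_gt0 n_gt0 co_mn dD.
have le := sorted_le_last srt; have rf := rank_set_flip m_gt0 n_gt0 co_mn rs le.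
have f0 : 0 \in flip (last 0 (sorted_ranks m n D)) (sorted_ranks m n D).
  apply/mapP; exists (last 0 (sorted_ranks m n D)); last by rewrite subnn.
  by case: (sorted_ranks _ _ _) r0 => // x s _; apply: mem_last.
have [E dE p] := dyck_of_rank_set m_gt0 n_gt0 co_mn rf f0.
exists E; last by rewrite area_defect // (defect_perm p).
split=> // x; rewrite (perm_mem p) max_ranks // /flip.
by apply: perm_mem; apply: perm_map; apply: perm_sorted_ranks.
Qed.

End Sweep.

(** * The operator L on words *)

Lemma count_leq_index (r : seq nat) (y : nat) : sorted ltn r -> y \in r ->
  count (fun z => z <= y) r = (index y r).+1.
Proof.
elim: r => // x r ih /= sr; have /allP lt := order_path_min ltn_trans sr.
rewrite in_cons [y == x]eq_sym; case: (eqVneq x y) => [<- _|xy /= yr].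
  rewrite leqnn; apply/eqP; rewrite eqSS -leqn0 leqNgt -has_count.
  by apply/hasPn => z /lt; rewrite -ltnNge.
by rewrite (ltnW (lt _ yr)) ih // (path_sorted sr).
Qed.

(** A common form for the action of L, which inserts a W at the rank [m + n], and for [child], which
    inserts it after S_c. *)
Definition moveW (w : word) (s j : nat) : word :=
  take s.-1 w ++ drop s (take j w) ++ false :: drop j w.

(** Equal counts of S mean that only W stand between [p] and [j], and a W inserted into a run of W
    gives the same word wherever it is put. *)
Lemma moveW_run (w : word) (s p j : nat) : s <= p -> p <= j -> j <= size w ->
  count_mem true (take p w) = count_mem true (take j w) -> moveW w s p = moveW w s j.
Proof.
move=> sp pj jw ct; rewrite /moveW; set u := drop p (take j w).
have ej : take j w = take p w ++ u by rewrite -{1}(cat_take_drop p (take j w)) take_takel.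
have ep : drop p w = u ++ drop j w.
  have : take p w ++ drop p w == take p w ++ (u ++ drop j w).
    by rewrite catA -ej !cat_take_drop.
  by rewrite eqseq_cat // eqxx => /eqP.
have eu : u = nseq (size u) false.
  move/eqP: ct; rewrite ej count_cat -[X in X == _]addn0 eqn_add2l eq_sym => /eqP cu.
  apply/all_pred1P/allP => b bu; move/eqP: cu; rewrite -leqn0 leqNgt -has_count.
  by move=> /hasPn/(_ b bu); case: b {bu}.
rewrite ep ej drop_cat size_takel ?(leq_trans pj) //.
have -> : (if s < p then drop s (take p w) ++ u else drop (s - p) u)
    = drop s (take p w) ++ u.
  case: (ltnP s p) => // ps; have -> : s = p by apply/eqP; rewrite eqn_leq sp.
  by rewrite subnn drop0 drop_oversize // size_take_min geq_minl.
rewrite -catA; congr (_ ++ (_ ++ _)); rewrite eu.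
by elim: (size u) => //= l <-.
Qed.

Lemma child_moveW (w : word) (c : nat) :
  s_pos w <= pos true c w -> pos true c w <= size w ->
  child w c = moveW w (s_pos w) (pos true c w).
Proof.
rewrite /child => sp pw; rewrite sp; set s := s_pos w; set p := pos true c w.
have s_gt0 : 0 < s by [].
rewrite take_cat size_takel // prednK // in sp *.
rewrite (leq_trans _ sp) ?prednK // take_takel; last by rewrite (leq_trans (leq_pred _)).
rewrite drop_cat size_takel // /moveW; case: (ltnP s p) => // ps.
have -> : s = p by apply/eqP; rewrite eqn_leq sp ps.
by rewrite subnn drop0 (drop_oversize (s := take p w)) // size_take_min geq_minl.
Qed.

Section Move.
Variables (w : word) (s j : nat).
Hypotheses (s_gt0 : 0 < s) (sj : s <= j) (jw : j <= size w).
Hypotheses (wT : take s w = rcons (nseq s.-1 true) false).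

Lemma word_split : w = nseq s.-1 true ++ false :: drop s (take j w) ++ drop j w.
Proof.
rewrite -cat_rcons -wT -{1}(cat_take_drop j w) -{1}(cat_take_drop s (take j w)).
by rewrite take_takel // catA.
Qed.

Lemma moveW_split : moveW w s j = nseq s.-1 true ++ drop s (take j w) ++ false :: drop j w.
Proof.
rewrite /moveW; congr (_ ++ _); rewrite -(take_takel _ (leq_pred s)) wT -cats1.
by rewrite take_size_cat // size_nseq.
Qed.

Lemma perm_moveW : perm_eq (moveW w s j) w.
Proof.
rewrite [X in perm_eq _ X]word_split moveW_split perm_cat2l.
by rewrite (perm_catCA _ [:: false]).
Qed.

(** Prefixes that end before [s] contain no W; for them the truncation of the predecessor at 0 gives
    the right value. *)
Lemma count_take_moveW i : count_mem false (take i (moveW w s j)) =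
  if i < j then (count_mem false (take i.+1 w)).-1 else count_mem false (take i w).
Proof.
set u := drop s (take j w); have su : size u = j - s by rewrite size_drop size_takel.
have ct k l : count_mem false (take k (nseq l true)) = 0.
  by elim: l k => [|l ih] [|k] //=; rewrite ih.
rewrite moveW_split [in RHS]word_split -/u; case: (ltnP i j) => ij.
  rewrite !take_cat size_nseq; case: (ltnP i s.-1) => is1.
    case: (ltnP i.+1 s.-1) => is2; first by rewrite !ct.
    have -> : i.+1 - s.-1 = 0 by clear -is1 is2; lia.
    by rewrite take0 cats0 ct count_nseq.
  have -> : (i.+1 < s.-1) = false by clear -is1; lia.
  rewrite subSn // !count_cat /= !count_nseq /= !add0n.
  rewrite take_cat su; case: ltnP => h //.
  have -> : i - s.-1 - (j - s) = 0 by clear -h ij sj s_gt0; lia.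
  by rewrite !take0 !cats0.
have e k : k = i - s.-1 - (size u).+1 -> take i (nseq s.-1 true ++ u ++ false :: drop j w)
   = nseq s.-1 true ++ u ++ false :: take k (drop j w).
  move=> ->; rewrite !take_cat size_nseq su.
  rewrite ltnNge (leq_trans _ ij) ?(leq_trans (leq_pred _)) //=.
  rewrite ltnNge (_ : j - s <= i - s.-1) /=; last by clear -ij sj s_gt0; lia.
  case E: (i - s.-1 - (j - s)) => [|l]; first by clear -E ij sj s_gt0; lia.
  by rewrite /= (_ : l = i - s.-1 - (j - s).+1) //; clear -E; lia.
have e' k : k = i - s.-1 - (size u).+1 -> take i (nseq s.-1 true ++ false :: u ++ drop j w)
   = nseq s.-1 true ++ false :: u ++ take k (drop j w).
  move=> ->; rewrite !take_cat size_nseq su.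
  rewrite ltnNge (leq_trans _ ij) ?(leq_trans (leq_pred _)) //=.
  case E: (i - s.-1) => [|l]; first by clear -E ij sj s_gt0; lia.
  rewrite /= take_cat su ltnNge (_ : j - s <= l) /=; last by clear -E ij sj s_gt0; lia.
  by rewrite subSS.
rewrite (e _ erefl) (e' _ erefl) !count_cat /= !count_cat /=.
by clear; lia.
Qed.

End Move.

(** On a sorted list L needs no sorting: 0 is the head, and [m + n] goes behind the ranks below it.
    In this form its effect on the word can be followed letter by letter. *)
Definition Lseq (m n : nat) (r : seq nat) : seq nat :=
  let s := behead r in
  let j := count (fun x => x < m + n) s in
  [seq x - head 0 s | x <- take j s ++ (m + n) :: drop j s].

(** * Ranks located in the word, and L on rank sequences *)

Section Lift.
Variables m n : nat.
Hypotheses (m_gt0 : 0 < m) (n_gt0 : 0 < n) (co_mn : coprime m n).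
Local Notation N := (m + n).
Local Notation rank_set := (rank_set m n).
Local Notation rank_seq := (rank_seq m n).
Local Notation labels := (labels m).
Local Notation is_dyck := (is_dyck m n).
Local Notation Lseq := (Lseq m n).
Local Notation top := (top_word m n).

Section Positions.
Variable r : seq nat.
Hypothesis rr : rank_seq r.

Let rs : rank_set r. Proof. by case/and3P: rr. Qed.
Let srt : sorted ltn r. Proof. by case/and3P: rr. Qed.
Let r0 : 0 \in r. Proof. by case/and3P: rr. Qed.
Let sz : size r = N. Proof. exact: rank_seq_size rr. Qed.

Lemma small_pred x : x \in r -> x < m -> x + n \in r.
Proof.
by move=> xr xm; case: (rank_set_pred m_gt0 n_gt0 co_mn rs xr) => // -[]; rewrite leqNgt xm.
Qed.

Lemma label_down y : y \in r -> n <= y -> y - n \in r -> (y + m \in r) = false.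
Proof.
move=> yr ny yn; apply/negP => ym.
by have := step_down_notin m_gt0 n_gt0 co_mn rs yr ym ny; rewrite yn.
Qed.

(** A rank below [m] cannot be the end of a u step, so the W up to rank [x + n] start exactly at the
    points [z + n] with [z] in [r] and [z <= x]. Among the W, the one at [x + n] therefore has the
    number that [x] has among all ranks. *)
Lemma pos_false_index x : x \in r -> x < m ->
  pos false (index x r).+1 (labels r) = (index (x + n) r).+1.
Proof.
move=> xr xm; have yr := small_pred xr xm; set y := x + n in yr *.
have yl : (y + m \in r) = false by apply: label_down; rewrite // /y ?leq_addl ?addnK.
have jN : index y r < N by rewrite -sz index_mem.
have e : nth (~~ false) (labels r) (index y r) = false.
  by rewrite (nth_map 0) ?sz // nth_index.
rewrite -(pos_eq _ e) ?size_labels ?sz //; congr pos.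
rewrite -(count_leq_index srt xr) /labels -map_take -(count_leq_index srt yr).
rewrite take_down //; last by move=> a b ab /(leq_trans ab).
rewrite count_map count_filter.
have p : perm_eq [seq z + n | z <- r & z <= x] [seq z <- r | (z <= y) && (z + m \notin r)].
  have u : uniq r by case/and3P: rs.
  apply: uniq_perm; rewrite ?(filter_uniq, map_inj_uniq (@addIn n)) //.
  move=> z; rewrite mem_filter; apply/mapP/andP => [[a]|[/andP[zy zm] zr]].
    rewrite mem_filter => /andP[ax ar] ->; rewrite leq_add2r ax.
    have am := small_pred ar (leq_ltn_trans ax xm).
    by rewrite am label_down // ?leq_addl ?addnK.
  case: (rank_setP rs zr) => [|[nz zn]]; first by rewrite (negPf zm).
  exists (z - n); last by rewrite subnK.
  by rewrite mem_filter zn andbT leq_subLR addnC.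
have := perm_size p; rewrite size_map !size_filter => ->.
by apply: eq_count => z /=; rewrite eqbF_neg andbC.
Qed.

Lemma index0 : index 0 r = 0.
Proof.
case: r r0 srt => // x s; rewrite in_cons => /orP[/eqP <- _ //|].
by move=> s0 /(order_path_min ltn_trans)/allP/(_ _ s0).
Qed.

Lemma fpos_index i : i * n < N -> i * n \in r /\ fpos (labels r) i = (index (i * n) r).+1.
Proof.
elim: i => [|i ih] iN; first by rewrite mul0n r0 index0.
have im : i * n < m by move: iN; rewrite mulSn; clear; lia.
have [ir ei] := ih (ltn_addr n im).
rewrite /fpos iterS -/(fpos (labels r) i) ei pos_false_index // mulSn addnC.
by rewrite small_pred.
Qed.

Lemma term_fpos i : i * n < N -> term r (fpos (labels r) i) = i * n.
Proof. by move=> /fpos_index[ir ->]; rewrite /term nth_index. Qed.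

Lemma nr : n \in r.
Proof. by rewrite -[n]add0n small_pred. Qed.

Lemma s_posE : s_pos (labels r) = (index n r).+1.
Proof. by have [|_] := @fpos_index 1; rewrite mul1n // -[X in X < _]add0n ltn_add2r. Qed.

(** Below rank [n] there is no room for a d step, and the rank [n] itself steps down to 0. *)
Lemma take_s_pos :
  take (s_pos (labels r)) (labels r)
    = rcons (nseq (s_pos (labels r)).-1 true) false.
Proof.
have lt : index n r < size r by rewrite index_mem nr.
rewrite s_posE (take_nth false) ?size_labels //= (nth_map 0) // nth_index ?nr //.
rewrite label_down ?nr ?subnn //; congr rcons.
rewrite /labels -map_take; set u := map _ _.
have su : size u = index n r by rewrite size_map size_takel // ltnW.
rewrite -su; apply/all_pred1P; apply/allP => _ /mapP[x xt ->].
have xr := mem_take xt.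
have xn : x < n.
  have := xt; rewrite -index_mem (size_takel (ltnW lt)) => xi.
  rewrite -(nth_index 0 xt) nth_take // -[X in _ < X](nth_index 0 nr).
  by apply: (sorted_ltn_nth ltn_trans) => //; rewrite inE; apply: ltn_trans lt.
case: (rank_setP rs xr) => [-> //|[]]; by rewrite leqNgt xn.
Qed.

Lemma N_notin : N \notin r.
Proof.
apply/negP => h; have := @rank_set_modI m n m_gt0 n_gt0 co_mn r rs 0 N r0 h.
by rewrite modnn mod0n => /(_ erefl); clear -m_gt0; lia.
Qed.

Lemma m_in : m \in r.
Proof.
case: (rank_setP rs r0) => [//|[]]; rewrite leqNgt n_gt0 //.
Qed.

End Positions.

Lemma rank_set_shift_down t R : rank_set R -> {in R, forall x, t <= x} ->
  rank_set [seq x - t | x <- R].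
Proof.
move=> /and3P[u /eqP s /allP h] le; apply/and3P; split.
- by rewrite map_inj_in_uniq // => x y /le tx /le ty; clear -tx ty; lia.
- by rewrite size_map s.
apply/allP => _ /mapP[x xR ->]; have tx := le x xR; apply/orP.
case/orP: (h x xR) => [xm|/andP[nx xn]]; [left | right].
  by apply/mapP; exists (x + m) => //; clear -tx; lia.
have tn := le _ xn; apply/andP; split; first by clear -tn nx; lia.
by apply/mapP; exists (x - n) => //; clear -tn nx; lia.
Qed.

Section LiftOne.
Variable r : seq nat.
Hypothesis rr : rank_seq r.

Let rs : rank_set r. Proof. by case/and3P: rr. Qed.
Let srt : sorted ltn r. Proof. by case/and3P: rr. Qed.
Let r0 : 0 \in r. Proof. by case/and3P: rr. Qed.
Let sz : size r = N. Proof. exact: rank_seq_size rr. Qed.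
Let s := behead r.
Let j := count (fun x => x < N) s.
Let t := head 0 s.
Let X := take j s ++ N :: drop j s.

Let rE : r = 0 :: s.
Proof. by have := index0 rr; rewrite /s; case: r r0 => //= x u _; case: eqVneq => // ->. Qed.

Let path_s : path ltn 0 s.
Proof. by move: srt; rewrite rE. Qed.

Let sorted_s : sorted ltn s. Proof. exact: path_sorted path_s. Qed.

Let s_gt0 x : x \in s -> 0 < x.
Proof. by have /allP h := order_path_min ltn_trans path_s; apply: h. Qed.

Let memX x : (x \in X) = (x == N) || (x \in s).
Proof.
by rewrite mem_cat in_cons orbCA -mem_cat cat_take_drop.
Qed.

Let perm_X : perm_eq X (N :: s).
Proof. by rewrite perm_catC /= perm_cons perm_catC cat_take_drop. Qed.

Let uniq_X : uniq X.
Proof.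
rewrite (perm_uniq perm_X) /= (sorted_uniq ltn_trans ltnn sorted_s) andbT.
by apply: contra (N_notin rr) => h; rewrite rE in_cons h orbT.
Qed.

Let in_s x : x \in r -> 0 < x -> x \in s.
Proof. by rewrite {1}rE in_cons => /orP[/eqP ->|]. Qed.

Let s_in x : x \in s -> x \in r.
Proof. by rewrite rE in_cons orbC => ->. Qed.

Let n_s : n \in s. Proof. by rewrite in_s ?(nr rr). Qed.

(** [m + n] takes the place of 0 in its class: [n] now steps up to it, and it steps down to [m]. *)
Lemma rank_set_X : rank_set X.
Proof.
apply/and3P; split=> //.
  by rewrite (perm_size perm_X) -sz rE.
apply/allP => x; rewrite memX => /orP[/eqP ->|xs].
  by rewrite leq_addl addnK !memX (in_s (m_in rr)) ?orbT.
case: (rank_setP rs (s_in xs)) => [xm|[nx xn]].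
  by rewrite memX (in_s xm) ?orbT // addn_gt0 m_gt0 orbT.
case: (posnP (x - n)) => [xn0|xn_gt0]; last by rewrite nx !memX (in_s xn) ?orbT.
have -> : x = n by clear -nx xn0; lia.
by rewrite memX addnC eqxx.
Qed.

Let t_le x : x \in s -> t <= x.
Proof.
rewrite /t; case: s path_s => //= y u /andP[_ p]; rewrite in_cons => /orP[/eqP -> //|xu].
by apply: ltnW; have /allP := order_path_min ltn_trans p; apply.
Qed.

Let t_s : t \in s. Proof. by rewrite /t; case: s n_s => //= y u _; rewrite mem_head. Qed.

Let t_leN : t <= N. Proof. by apply: leq_trans (t_le n_s) _; apply: leq_addl. Qed.

Let t_leX x : x \in X -> t <= x.
Proof. by rewrite memX => /orP[/eqP ->|/t_le]. Qed.

Let low_s x : x \in take j s -> x < N.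
Proof.
rewrite take_down //; first by rewrite mem_filter => /andP[].
by move=> a b ab; apply: leq_ltn_trans.
Qed.

Let high_s x : x \in drop j s -> N < x.
Proof.
move=> xd; have xs := mem_drop xd; rewrite ltn_neqAle leqNgt; apply/andP; split.
  by apply: contraTneq (s_in xs) => <-; apply: N_notin rr.
apply/negP => xN; have : x \in take j s.
  rewrite take_down ?mem_filter ?xN //; by move=> a b ab; apply: leq_ltn_trans.
move: xd; have := sorted_uniq ltn_trans ltnn sorted_s.
rewrite -{1}(cat_take_drop j s) cat_uniq => /and3P[_ /hasPn h _] /h /negP h' ?.
exact: h'.
Qed.

Lemma sorted_X : sorted ltn X.
Proof.
rewrite sorted_pairwise; last exact: ltn_trans.
rewrite pairwise_cat /=; move: sorted_s.
rewrite (sorted_pairwise ltn_trans) -{1}(cat_take_drop j s).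
rewrite pairwise_cat => /and3P[/allrelP h -> ->]; rewrite !andbT.
apply/andP; split; last by apply/allP => x /high_s.
apply/allrelP => x y xt; rewrite in_cons => /orP[/eqP ->|]; first exact: low_s.
exact: h.
Qed.

Lemma LseqE : Lseq r = [seq x - t | x <- X]. Proof. by []. Qed.

Lemma rank_seq_Lseq : rank_seq (Lseq r).
Proof.
rewrite LseqE; apply/and3P; split; first exact: rank_set_shift_down rank_set_X _.
  apply: (homo_sorted_in (P := mem X) _ _ sorted_X); last by apply/allP.
  by move=> x y /t_leX tx /t_leX ty xy; clear -tx ty xy; lia.
by apply/mapP; exists t; rewrite ?subnn // memX t_s orbT.
Qed.

Lemma Lop_Lseq R : perm_eq R r -> Lop m n R = Lseq r.
Proof.
move=> pR; rewrite /Lop.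
have p1 : perm_eq (rem 0 R) s.
  rewrite -(perm_cons 0) -rE; apply: (perm_trans _ pR); rewrite perm_sym.
  by apply: perm_to_rem; rewrite (perm_mem pR).
have e1 : sort leq (rem 0 R) = s.
  apply: (sorted_eq leq_trans anti_leq); rewrite ?sort_sorted //; first exact: leq_total.
    by apply: sub_sorted sorted_s; apply: ltnW.
  by rewrite perm_sort.
rewrite e1 -/t; apply: (sorted_eq leq_trans anti_leq).
- by rewrite sort_sorted //; apply: leq_total.
- by have /and3P[_ h _] := rank_seq_Lseq; apply: sub_sorted h; apply: ltnW.
rewrite perm_sort LseqE; apply: perm_map; rewrite perm_rcons perm_sym.
by apply: perm_trans perm_X _; rewrite perm_cons perm_sym.
Qed.

(** The S of rank 0 disappears, the W of rank [n] becomes an S, and [m + n] brings a new W. As the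
    word begins with a run of S followed by the W of [n], dropping the first S and turning this W
    into an S amounts to deleting the W. *)
Lemma labels_Lseq :
  labels (Lseq r)
    = moveW (labels r) (s_pos (labels r)) (count (fun x => x < N) r).
Proof.
have m_X x : x \in X -> (x - t + m \in Lseq r) = (x + m \in X).
  rewrite LseqE => xX; have tx := t_leX xX; apply/mapP/idP => [[y yX e]|xm].
    have ty := t_leX yX; suff -> : x + m = y by [].
    by clear -tx ty e; lia.
  by exists (x + m) => //; clear -tx; lia.
have -> : labels (Lseq r) = [seq x + m \in X | x <- X].
  by rewrite /labels {2}LseqE -map_comp; apply/eq_in_map => x /m_X.
have lab x : x \in s -> x != n -> (x + m \in X) = (x + m \in r).
  move=> xs xn; rewrite memX [in RHS]rE in_cons -/s addnC eqn_add2l (negPf xn).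
  by rewrite addn_eq0 (gtn_eqF m_gt0).
have labn : (n + m \in X) = true by rewrite memX addnC eqxx.
have labN : (N + m \in X) = false.
  apply/negP => h; have := step_down_notin m_gt0 n_gt0 co_mn rank_set_X _ h (leq_addl m n).
  by rewrite addnK !memX eqxx (in_s (m_in rr)) ?orbT // => /(_ isT).
have [e0 nt] : index n r = (index n s).+1 /\ n \in take j s.
  split; first by rewrite rE /= (ltn_eqF n_gt0).
  rewrite take_down ?mem_filter ?n_s ?andbT; first by clear -m_gt0; lia.
    exact: sorted_s.
  by move=> a b ab; apply: leq_ltn_trans.
set i := index n s in e0.
have ij : i < j.
  have e : index n (take j s) = i by rewrite /i -{2}(cat_take_drop j s) index_cat nt.
  by rewrite -e -[X in _ < X](size_takel (count_size _ _ : j <= size s)) ?count_size // index_mem.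
have et : take j s = take i s ++ n :: drop i.+1 (take j s).
  rewrite -{1}(cat_take_drop i (take j s)) take_takel ?(ltnW ij) //.
  rewrite (drop_nth 0) ?size_takel ?count_size //; congr (_ ++ _ :: _).
  by rewrite nth_take // nth_index.
have us : uniq (take j s) by apply: take_uniq; apply: (sorted_uniq ltn_trans ltnn).
have sub x : x \in take j s -> x \in s by apply: mem_take.
move: (us); rewrite {1}et cat_uniq cons_uniq => /and3P[_ /hasPn nti /andP[nd _]].
have ei : map (fun x => x + m \in r) (take i s) = nseq i true.
  have := take_s_pos rr; rewrite s_posE // e0 => /(congr1 (take i.+1)).
  rewrite take_takel // -cats1 take_size_cat ?size_nseq // rE /= => -[_ <-].
  by rewrite -map_take -rE.
have eiX : map (fun x => x + m \in X) (take i s) = nseq i true.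
  rewrite -ei; apply/eq_in_map => x xi; apply: lab; first exact: mem_take xi.
  by apply: contraTneq xi => ->; apply: nti; rewrite mem_head.
have mapX (f : nat -> bool) : map f X = map f (take j s) ++ f N :: map f (drop j s).
  by rewrite map_cat.
rewrite mapX labN et map_cat /= labn eiX.
rewrite /moveW s_posE // e0 [X in count _ X]rE /= -/j.
rewrite [in RHS]rE /= -rE -!map_take -!map_drop.
have -> : [seq x + m \in X | x <- drop i.+1 (take j s)]
    = [seq x + m \in r | x <- drop i.+1 (take j s)].
  apply/eq_in_map => x xd; apply: lab; first exact/sub/(mem_drop xd).
  by apply: contraNneq nd => <-.
have -> : [seq x + m \in X | x <- drop j s] = [seq x + m \in r | x <- drop j s].
  apply/eq_in_map => x xd; apply: lab; first exact: mem_drop xd.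
  by have := high_s xd; case: eqP => // -> ; clear; lia.
have dr l : drop l.+1 r = drop l s by rewrite rE.
have tr : take j.+1 r = 0 :: take j s by rewrite rE.
rewrite addn_gt0 m_gt0 add1n tr dr ei add0n m_in //= -catA.
have swap l (v : word) : nseq l true ++ true :: v = true :: nseq l true ++ v.
  by elim: l => //= l ->.
exact: swap.
Qed.

Lemma last_Lseq : N < last 0 r -> last 0 (Lseq r) = last 0 r - t.
Proof.
move=> NM; have /and3P[_ srt' l0] := rank_seq_Lseq; have le := sorted_le_last srt'.
have Mr : last 0 r \in r by rewrite rE /= mem_last.
have MX : last 0 r \in X by rewrite memX in_s ?orbT // (leq_trans _ NM).
apply/eqP; rewrite eqn_leq; apply/andP; split; last first.
  by apply: le; rewrite LseqE; apply/mapP; exists (last 0 r).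
have : last 0 (Lseq r) \in Lseq r.
  by case: (Lseq r) l0 => // x u _; apply: mem_last.
rewrite {2}LseqE => /mapP[x xX ->]; rewrite leq_sub2r //.
by move: xX; rewrite memX => /orP[/eqP ->|/s_in/(sorted_le_last srt)//]; apply: ltnW.
Qed.

(** In the complement, L moves the top element [M] down to [M - N] in its class. The profile gains
    exactly one from there on, so the defect loses one. *)
Lemma codefect_Lseq : N < last 0 r -> (codefect m n (Lseq r)).+1 = codefect m n r.
Proof.
move=> NM; set M := last 0 r.
have leM : {in r, forall x, x <= M} := sorted_le_last srt.
have /and3P[rs' srt' _] := rank_seq_Lseq.
have r_E := rank_set_flip m_gt0 n_gt0 co_mn rs leM.
have r_E' := rank_set_flip m_gt0 n_gt0 co_mn rs' (sorted_le_last srt').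
set E := flip M r in r_E; set E' := flip _ _ in r_E'.
have Mr : M \in r by rewrite /M rE /= mem_last.
have ME : M \in E by apply/mapP; exists 0; rewrite ?subn0.
have memE' e : reflect (exists2 x, x \in X & e = M - x) (e \in E').
  have eM : last 0 (Lseq r) = M - t by apply: last_Lseq.
  rewrite /E' eM LseqE; apply: (iffP mapP) => [[_ /mapP[x xX ->] ->]|[x xX ->]].
    by exists x => //; have := t_leX xX; clear; lia.
  exists (x - t); first by apply/mapP; exists x.
  by have := t_leX xX; clear; lia.
have ab' e : above m n E' e = above m n E e + (e == M - N) :> nat.
  have nab : above m n E (M - N) = false.
    apply/negP => /(above_le m_gt0 n_gt0 co_mn r_E ME).
    rewrite -{1}(subnK (ltnW NM : N <= M)) modnDr => /(_ erefl).
    by move: NM; rewrite -/M; clear -m_gt0; lia.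
  case: (eqVneq e (M - N)) => [->|eMN].
    rewrite nab; congr nat_of_bool; apply/aboveP; exists (M - N) => //.
    by apply/memE'; exists N => //; rewrite memX eqxx.
  rewrite addn0; congr nat_of_bool; apply/aboveP/aboveP => -[x].
    move=> /memE'[y]; rewrite memX => /orP[/eqP ->|ys] -> [le em].
      exists M => //; split; last by rewrite -em -{1}(subnK (ltnW NM : N <= M)) modnDr.
      have dv : N %| e - (M - N) by rewrite -eqn_mod_dvd // em.
      have := dvdn_leq _ dv; rewrite subn_gt0 ltn_neqAle eq_sym eMN le => /(_ isT).
      by clear -NM le; lia.
    by exists (M - y) => //; apply/mapP; exists y => //; apply: s_in.
  move=> /mapP[y yr ->] [le em]; case: (posnP y) => y0.
    exists (M - N); first by apply/memE'; exists N => //; rewrite memX eqxx.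
    move: le em; rewrite y0 subn0 => le em; split; first by clear -le; lia.
    by rewrite -em -[in RHS](subnK (ltnW NM : N <= M)) modnDr.
  by exists (M - y) => //; apply/memE'; exists y => //; rewrite memX (in_s yr y0) orbT.
have pE' i : prof m n E' i = prof m n E i + (M - N < i).
  elim: i => [|i ih]; first by rewrite ltn0.
  rewrite [LHS]profS [prof m n E i.+1]profS ih ab' ltnS.
  by case: (ltngtP (M - N) i) => _; clear; lia.
have [i1 d1] := prof_defect m_gt0 n_gt0 co_mn r_E.
have [i2 d2] := prof_defect m_gt0 n_gt0 co_mn r_E'.
have := d1 (i1 + i2 + M.+1); have := d2 (i1 + i2 + M.+1).
rewrite pE' /codefect -/E -/E' -/M.
have -> : M - N < i1 + i2 + M.+1 by clear; lia.
by rewrite /M; clear; lia.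
Qed.

End LiftOne.
End Lift.

(** * Accepted candidates *)

Lemma pos_ge (b : bool) (j : nat) (w : word) :
  0 < j -> j <= (size w).+1 -> j <= pos b j w.
Proof.
case: j => // j _; rewrite ltnS => jw; rewrite ltnNge posP // -ltnNge ltnS.
by apply: leq_trans (count_size _ _) _; rewrite size_take_min geq_minl.
Qed.

Lemma fpos_mono (w : word) (i j : nat) : i <= j -> fpos w i <= fpos w j.
Proof.
have bd l : 0 < fpos w l <= (size w).+1 by case: l => [|l] //=; rewrite pos_le_size.
move=> /subnKC <-; elim: (j - i) => [|l ih]; first by rewrite addn0.
rewrite addnS; apply: leq_trans ih _; have /andP[] := bd (i + l).
exact: pos_ge.
Qed.

Section Search.
Variables m n : nat.
Hypotheses (m_gt0 : 0 < m) (n_gt0 : 0 < n) (co_mn : coprime m n).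
Local Notation N := (m + n).
Local Notation rank_set := (rank_set m n).
Local Notation rank_seq := (rank_seq m n).
Local Notation labels := (labels m).
Local Notation is_dyck := (is_dyck m n).
Local Notation Lseq := (Lseq m n).
Local Notation top := (top_word m n).
Local Notation below := (count (fun x => x < N)).

Lemma rank_seq_iota : rank_seq (iota 0 N).
Proof.
apply/and3P; split; [|exact: iota_ltn_sorted | by rewrite mem_iota; clear -m_gt0; lia].
apply/and3P; split; rewrite ?iota_uniq ?size_iota //.
by apply/allP => x; rewrite !mem_iota; clear; lia.
Qed.

Lemma labels_iota : labels (iota 0 N) = top.
Proof.
have const b (f : nat -> bool) i l : {in iota i l, forall x, f x = b} ->
    map f (iota i l) = nseq l b.
  move=> h; have -> : map f (iota i l) = map (fun=> b) (iota i l) by apply/eq_in_map.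
  by elim: l i {h} => //= l ih i; rewrite ih.
rewrite /labels /top_word; have e : iota 0 N = iota 0 n ++ iota n m by rewrite addnC iotaD.
by rewrite {2}e map_cat; congr (_ ++ _); apply: const => x; rewrite !mem_iota; clear; lia.
Qed.

Lemma last_gt r : rank_seq r -> labels r != top -> N < last 0 r.
Proof.
move=> rr; rewrite ltnNge; apply: contra => le.
have /and3P[/and3P[ur /eqP sz _] srt r0] := rr.
suff -> : r = iota 0 N by rewrite labels_iota.
have sub : {subset r <= iota 0 N}.
  move=> x xr; rewrite mem_iota add0n ltn_neqAle (leq_trans (sorted_le_last srt xr)) // andbT.
  by apply: contraTneq xr => ->; apply: N_notin rr.
apply: (irr_sorted_eq ltn_trans ltnn) => //; first exact: iota_ltn_sorted.
by have [|_] := uniq_min_size ur sub; rewrite // size_iota sz.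
Qed.

Lemma codefect_iota : codefect m n (iota 0 N) = 0.
Proof.
have rr := rank_seq_iota; have /and3P[rs srt r0] := rr.
have l : last 0 (iota 0 N) = N.-1.
  by rewrite -nth_last size_iota nth_iota ?add0n //; clear -m_gt0; lia.
rewrite /codefect l /defect big_seq_cond big1 // => x /andP[/mapP[y yN ->]].
move=> /mapP[z zN e]; apply: divn_small; move: yN zN e.
by rewrite !mem_iota; clear -n_gt0; lia.
Qed.

(** Since [s <= a] and [a] precedes S_{c+1}, the label [c] is at least [s - 1]. If [c = s - 1], the
    inserted W is adjacent to the deleted one and the word does not change, so a proper child moves
    the W across at least one S. *)
Lemma candidate_move w c : is_dyck w -> c \in candidates m n w -> child w c != w ->
  [/\ s_pos w < pos true c w, pos true c w <= size w, 0 < c &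
      child w c = moveW w (s_pos w) (pos true c w)].
Proof.
move=> dw; have [r rr <-] := dyck_onto m_gt0 n_gt0 co_mn dw; set v := labels r.
have ct : count_mem true v = n by apply: count_true_labels.
have tk := take_s_pos m_gt0 n_gt0 co_mn rr; rewrite -/v in tk.
have s_gt0 : 0 < s_pos v by [].
have s_le : s_pos v <= size v.
  have := congr1 size tk; rewrite size_take_min size_rcons size_nseq prednK // => <-.
  exact: geq_minr.
have cs : count_mem true (take (s_pos v) v) = (s_pos v).-1.
  by rewrite tk -cats1 count_cat count_nseq /= mul1n !addn0.
rewrite mem_filter mem_iota add1n ltnS => /andP[/andP[ac _] /andP[c_gt0 cn]] ne.
have pv : pos true c v <= size v by rewrite posP // take_size ct.
have sa : s_pos v <= a_pos m n v by apply: fpos_mono.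
have sc : (s_pos v).-1 <= c.
  have := leq_ltn_trans sa ac; rewrite ltnNge posP // cs -ltnNge ltnS.
  by [].
case: (ltnP (s_pos v) (pos true c v)) => sp.
  by split=> //; apply: child_moveW => //; apply: ltnW.
case/eqP: ne.
have ec : c = (s_pos v).-1.
  by apply/eqP; rewrite eqn_leq sc andbT -cs -posP.
have ep : pos true c v = (s_pos v).-1.
  have sv : (s_pos v).-1 <= size v by apply: leq_trans (leq_pred _) s_le.
  apply/eqP; rewrite eqn_leq; apply/andP; split; last first.
    by rewrite -ec pos_ge // ec leqW.
  rewrite posP // -(take_takel _ (leq_pred (s_pos v))) tk.
  by rewrite -cats1 take_size_cat ?size_nseq // count_nseq mul1n ec.
have es : s_pos v = (pos true c v).+1 by rewrite ep prednK.
rewrite /child es; move: pv es; set p := pos true c v => pv es.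
rewrite ltnn -cat1s catA /=.
rewrite take_size_cat; last by rewrite size_cat size_takel ?addn1.
rewrite -(add1n p.+1) -drop_drop drop_size_cat; last by rewrite size_cat size_takel ?addn1.
rewrite drop_drop add1n -[RHS](cat_take_drop p.+1); congr (_ ++ _).
rewrite -es tk -cats1; congr (_ ++ _).
have := congr1 (take p) tk; rewrite es take_takel // -cats1 take_size_cat //.
by rewrite size_nseq.
Qed.

Lemma dyck_take_s_pos w : is_dyck w ->
  take (s_pos w) w = rcons (nseq (s_pos w).-1 true) false.
Proof.
move=> /(dyck_onto m_gt0 n_gt0 co_mn)[r rr <-].
exact: (take_s_pos m_gt0 n_gt0 co_mn rr).
Qed.

Lemma count_takeS (b : bool) (w : word) i :
  count_mem b (take i.+1 w) <= (count_mem b (take i w)).+1.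
Proof.
rewrite -addn1 takeD count_cat -[leqRHS]addn1 leq_add2l.
by case: (drop i w) => //= x u; rewrite take0 addn0 leq_b1.
Qed.

Lemma moveW_dyck w j : is_dyck w -> s_pos w <= j -> j <= size w ->
  is_dyck (moveW w (s_pos w) j).
Proof.
move=> dw sj jw; have tk := dyck_take_s_pos dw.
have p := perm_moveW sj tk; have [ct cf sw_ le] := dyckE dw.
apply: dyckI => [||i iN]; rewrite ?(permP p) //.
have := count_mem_bool (take i (moveW w (s_pos w) j)).
have := count_mem_bool (take i w); rewrite !size_take_min (perm_size p) => <-.
have : count_mem false (take i (moveW w (s_pos w) j)) <= count_mem false (take i w).
  rewrite count_take_moveW //; case: ifP => // _.
  by have := count_takeS false w i; case: (count_mem false (take i.+1 w)).
have := le i; set f := count_mem false _; set u := count_mem true _.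
set f' := count_mem false _; set u' := count_mem true _; clear; nia.
Qed.

(** The termination measure behind the fuel: moving a W to the right raises the number of W in no
    prefix. *)
Definition W_sum (w : word) := \sum_(i < (size w).+1) count_mem false (take i w).

Lemma child_dyck w c : is_dyck w -> c \in candidates m n w -> child w c != w ->
  is_dyck (child w c) /\ W_sum (child w c) < W_sum w.
Proof.
move=> dw hc ne; have [sp pw c_gt0 ->] := candidate_move dw hc ne.
have tk := dyck_take_s_pos dw; have sp' := ltnW sp.
split; first exact: moveW_dyck.
have lp := @nth_pos true w c false pw; have p_gt0 : 0 < pos true c w by [].
move: (pos true c w) sp pw sp' p_gt0 lp => p sp pw sp' p_gt0 lp.
(* The prefix of length [p - 1] strictly loses a W: it contained the deleted one, and the letter
   shifted into it is S_c. *)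
have p1 : p.-1 < (size w).+1 by rewrite ltnS (leq_trans (leq_pred _)).
rewrite /W_sum (perm_size (perm_moveW sp' tk)).
rewrite (bigD1 (Ordinal p1)) // [ltnRHS](bigD1 (Ordinal p1)) //= -addSn leq_add //.
  rewrite count_take_moveW // prednK // leqnn.
  have e : take p w = rcons (take p.-1 w) true.
    by rewrite -{1}(prednK p_gt0) (take_nth false) ?prednK // lp.
  have f0 : 0 < count_mem false (take p.-1 w).
    have -> : p.-1 = s_pos w + (p.-1 - s_pos w) by rewrite subnKC // -ltnS prednK.
    by rewrite takeD count_cat tk -cats1 count_cat /=; clear; lia.
  by rewrite e -cats1 count_cat /= !addn0 prednK.
apply: leq_sum => i _; rewrite count_take_moveW //; case: ifP => // _.
by have := count_takeS false w i; case: (count_mem false (take i.+1 w)).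
Qed.

Lemma tails_le (w1 w2 : word) : size w1 = size w2 ->
  count_mem true w1 = count_mem true w2 ->
  (forall i, count_mem false (take i w1) <= count_mem false (take i w2)) ->
  forall q, tails w1 q <= tails w2 q.
Proof.
move=> es ec le q; rewrite /tails es; set i := size w2 - q.
have := count_mem_bool (take i w1); have := count_mem_bool (take i w2).
rewrite !size_take_min es => <-; have := le i.
move: ec; rewrite -{1}(cat_take_drop i w1) -{1}(cat_take_drop i w2) !count_cat.
by clear; lia.
Qed.

(** A larger [c] puts the W further right, where it displaces S from the tails. Through
    [codefect_le] this bounds the tree of a candidate beyond key(R). *)
Lemma child_tails w c1 c2 : is_dyck w -> c1 <= c2 ->
  c1 \in candidates m n w -> child w c1 != w ->
  c2 \in candidates m n w -> child w c2 != w ->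
  forall q, tails (child w c2) q <= tails (child w c1) q.
Proof.
move=> dw c12 hc1 ne1 hc2 ne2; have tk := dyck_take_s_pos dw.
have [sp1 pw1 c1_gt0 ->] := candidate_move dw hc1 ne1.
have [sp2 pw2 c2_gt0 ->] := candidate_move dw hc2 ne2.
have q1 := perm_moveW (ltnW sp1) tk; have q2 := perm_moveW (ltnW sp2) tk.
apply: tails_le; rewrite ?(perm_size q1) ?(perm_size q2) ?(permP q1) ?(permP q2) //.
have p12 : pos true c1 w <= pos true c2 w.
  by rewrite posP // (leq_trans c12) // -posP.
move=> i; rewrite !count_take_moveW ?(ltnW sp1) ?(ltnW sp2) //.
have := count_takeS false w i.
case: (ltnP i (pos true c1 w)) => h1; first by rewrite (leq_trans h1).
by case: ifP => // _; case: (count_mem false (take i.+1 w)).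
Qed.

Lemma dyck_s_pos_gt1 w : is_dyck w -> 1 < s_pos w.
Proof.
move=> dw; have [_ _ _ le] := dyckE dw; rewrite ltnNge; apply/negP => s1.
have e : s_pos w = 1 by apply/eqP; rewrite eqn_leq s1.
have := le 1; have := dyck_take_s_pos dw; rewrite e => -> /=.
by rewrite muln0 addn0 muln1 leqNgt n_gt0.
Qed.

Lemma count_lt_index (r : seq nat) (y : nat) : sorted ltn r -> y \in r ->
  count (fun z => z < y) r = index y r.
Proof.
move=> sr yr; have := count_leq_index sr yr.
have := count_ltnS xpredT y (sorted_uniq ltn_trans ltnn sr); rewrite yr /= addn1.
by move=> -> [].
Qed.

(** * What an accepted candidate yields *)

Section Accept.
Variables (w : word) (c : nat) (r r' : seq nat).
Hypotheses (dw : is_dyck w) (hc : c \in candidates m n w) (ne : child w c != w).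
Hypotheses (rr' : rank_seq r') (er' : labels r' = child w c).
Hypothesis acc : accept m n w c (child w c) r' = Some r.

Let s := s_pos w.
(** The leading 0 of [r] and indexing from 0 make [s.-2] the index of the element that becomes the
    rank [n] at position [s]. The shift by [t] sends [x] to [n] and [y] to [m + n]. *)
Let x := nth 0 r' s.-2.
Let y := x + m.
Let i := index y r'.
Let t := n - x.
Let Q := rem y r'.

Let sz : size r' = N. Proof. exact: rank_seq_size rr'. Qed.
Let rs' : rank_set r'. Proof. by case/and3P: rr'. Qed.
Let srt' : sorted ltn r'. Proof. by case/and3P: rr'. Qed.
Let u' : uniq r'. Proof. exact: (sorted_uniq ltn_trans ltnn srt'). Qed.
Let s_gt1 : 1 < s. Proof. exact: dyck_s_pos_gt1. Qed.

Let accE : [/\ y \in r', nth true (child w c) i = false, pos true c w <= i.+1,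
  i.+1 < pos true c.+1 w & r = 0 :: [seq z + t | z <- Q] ].
Proof.
move: acc; rewrite /accept /term -/s -/x -/y -/i -/t /= -remE -/Q.
by case: ifP => // /and4P[yr /eqP nt pi ip] [<-].
Qed.

Let y_in : y \in r'. Proof. by case: accE. Qed.
Let iN : i < N. Proof. by rewrite -sz index_mem. Qed.
Let sw_ : size w = N. Proof. by case/dyckE: dw. Qed.

Let cnt : count_mem true (take i.+1 w) = c.
Proof.
have [_ _ pi ip _] := accE; have [_ _ c_gt0 _] := candidate_move dw hc ne.
apply/eqP; rewrite eqn_leq -[c <= _]posP ?sw_ // pi andbT -ltnS.
by move: ip; rewrite ltnNge posP ?sw_ // -ltnNge.
Qed.

Let si : s <= i.+1.
Proof.
have [_ _ pi _ _] := accE; have [sp _ _ _] := candidate_move dw hc ne.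
exact: leq_trans (ltnW sp) pi.
Qed.

Let childE : labels r' = moveW w s i.+1.
Proof.
have [_ _ pi ip _] := accE; have [sp pw c_gt0 e] := candidate_move dw hc ne.
rewrite er' e; apply: moveW_run => //; rewrite ?sw_ ?(ltnW sp) //.
rewrite cnt; apply/eqP; rewrite eqn_leq -[c <= _]posP // leqnn andbT.
by rewrite -[X in _ <= X]cnt count_take_mono.
Qed.

Let U := drop s (take i.+1 w).
Let V := drop i.+1 w.

Let tk : take s w = rcons (nseq s.-1 true) false. Proof. exact: dyck_take_s_pos. Qed.

Let wE : w = nseq s.-1 true ++ false :: U ++ V. Proof. exact: word_split. Qed.

Let w'E : labels r' = nseq s.-1 true ++ U ++ false :: V.
Proof. by rewrite childE moveW_split. Qed.

Let size_U : size U = i.+1 - s. Proof. by rewrite size_drop size_takel ?sw_. Qed.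

Let x_in : x \in r'.
Proof. by apply: mem_nth; rewrite sz; move: si iN s_gt1; clear; lia. Qed.

(** The first [s - 1] letters of the child are S, whereas the rank [n] of [r'] carries a W and thus
    stands behind them, after [x]. *)
Let x_lt : x < n.
Proof.
have nr' := nr m_gt0 n_gt0 co_mn rr'.
have ni : s.-1 <= index n r'.
  rewrite leqNgt; apply/negP => lt; have := label_down m_gt0 n_gt0 co_mn rr' nr' (leqnn _).
  rewrite subnn => h; have {h} : (n + m \in r') = false by apply: h; case/and3P: rr'.
  have -> : (n + m \in r') = nth false (labels r') (index n r').
    by rewrite (nth_map 0) ?index_mem // nth_index.
  by rewrite w'E nth_cat size_nseq lt nth_nseq lt.
rewrite -(nth_index 0 nr') /x.
apply: (sorted_ltn_nth ltn_trans) => //; rewrite ?inE ?index_mem //.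
  by rewrite sz; move: si iN s_gt1; clear; lia.
by move: ni s_gt1; clear; lia.
Qed.

Let y_down : n <= y /\ y - n \in r'.
Proof.
have [_ h _ _ _] := accE; case: (rank_setP rs' y_in) => // ym.
by move: h; rewrite -er' (nth_map 0) ?index_mem // nth_index // ym.
Qed.

Let t_gt0 : 0 < t. Proof. by rewrite subn_gt0. Qed.
Let yt : y + t = N. Proof. by rewrite /y /t; move: x_lt; clear; lia. Qed.

Let memQ z : (z \in Q) = (z != y) && (z \in r').
Proof. by rewrite mem_rem_uniq ?inE. Qed.

Let rE : r = 0 :: [seq z + t | z <- Q]. Proof. by case: accE. Qed.

Let mem_r z : (z + t \in r) = (z \in Q).
Proof. by rewrite rE in_cons addn_eq0 (gtn_eqF t_gt0) andbF (mem_map (@addIn t)). Qed.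

Let rank_set_r : rank_set r.
Proof.
apply/and3P; split.
- rewrite rE /= (map_inj_uniq (@addIn t)) rem_uniq // andbT.
  by apply/mapP => -[z _]; move: t_gt0; clear; lia.
- by rewrite rE /= size_map size_rem // sz; move: m_gt0; clear; lia.
apply/allP => a; rewrite {1}rE in_cons => /orP[/eqP ->|/mapP[z zQ ->]].
  have [ny yn] := y_down; rewrite add0n (_ : m = y - n + t) ?mem_r ?memQ ?yn ?andbT.
    by rewrite (_ : y - n != y) //; apply/eqP; move: ny n_gt0; clear; lia.
  by move: ny x_lt; rewrite /t /y; clear; lia.
move: (zQ); rewrite memQ => /andP[zy zr].
(* [x] becomes [n] and steps down to the new 0. Every other step survives the removal of [y], since
   only an element of the class of [x] can lead to [y]. *)
case: (eqVneq z x) => [->|zx].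
  rewrite [x + t]subnKC ?(ltnW x_lt) // leqnn subnn; apply/orP; right.
  by rewrite rE mem_head.
rewrite addnAC mem_r memQ; case: (rank_setP rs' zr) => [zm|[nz zn]].
  by rewrite zm andbT /y eqn_add2r zx.
rewrite (leq_trans nz) ?leq_addr //= -addnBAC // mem_r memQ zn andbT.
apply/orP; right; apply/eqP => e.
suff : z = x by move/eqP; rewrite (negPf zx).
apply: (rank_set_modI m_gt0 n_gt0 co_mn rs') => //.
by rewrite -(subnK nz) e /y -addnA modnDr.
Qed.

Lemma accept_rank_seq : rank_seq r.
Proof.
apply/and3P; split; [exact: rank_set_r | | by rewrite rE mem_head].
rewrite rE /= path_min_sorted; last first.
  by apply/allP => _ /mapP[z _ ->]; rewrite /= addn_gt0 t_gt0 orbT.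
apply: (homo_sorted (e := ltn)); first by move=> a b; rewrite /= ltn_add2r.
exact: (subseq_sorted ltn_trans (rem_subseq _ _) srt').
Qed.

Let QE : Q = take i r' ++ drop i.+1 r'. Proof. by rewrite /Q remE. Qed.

Lemma accept_below : below r = i.+1.
Proof.
rewrite rE /= addn_gt0 m_gt0 add1n count_map; congr _.+1.
rewrite (eq_count (a2 := fun z => z < y)); last first.
  by move=> z /=; rewrite -yt ltn_add2r.
by rewrite count_rem ltnn andbF subn0 count_lt_index.
Qed.

Lemma accept_count : count_mem true (take (below r) w) = c.
Proof. by rewrite accept_below. Qed.

Lemma accept_Lseq : Lseq r = r'.
Proof.
have r0' : nth 0 r' 0 = 0.
  by rewrite -[X in nth 0 r' X](index0 rr') nth_index //; case/and3P: rr'.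
have i_gt0 : 0 < i by move: si s_gt1; clear; lia.
rewrite /Lseq rE /=.
have -> : count (fun a => a < N) [seq z + t | z <- Q] = i.
  by apply/eqP; rewrite -eqSS -accept_below rE /= addn_gt0 m_gt0.
have st : size (take i r') = i by rewrite size_takel // sz ltnW.
rewrite -map_take -map_drop QE take_size_cat // drop_size_cat //.
have -> : head 0 [seq z + t | z <- take i r' ++ drop i.+1 r'] = t.
  case: (r') r0' sz => [_ /esym/eqP|a u /= -> _]; first by rewrite addn_eq0 (gtn_eqF m_gt0).
  by case: (i) i_gt0.
have ny : nth 0 r' i = y by apply: nth_index.
rewrite -[in RHS](cat_take_drop i r') [drop i r'](drop_nth 0) ?sz // ny -yt.
rewrite -[y + t :: _]/[seq z + t | z <- y :: drop i.+1 r'] -map_cat -map_comp.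
by rewrite -[RHS]map_id; apply: eq_map => z /=; rewrite addnK.
Qed.

(** The word of [r'] is S^(s-1) U W V. The new 0 contributes an S in front, [x] turns from S into W,
    and the W of [y] is removed; the result is S^(s-1) W U V, which is [w]. *)
Lemma accept_labels : labels r = w.
Proof.
have m_r : m \in r by apply: m_in accept_rank_seq.
rewrite /labels {2}rE /= m_r -map_comp.
pose f z := (z != x) && (z + m \in r').
pose labels_of u : word := [seq z + m \in r' | z <- u].
have -> : [seq ((fun a => a + m \in r) \o addn^~ t) z | z <- Q] = map f Q.
  apply/eq_in_map => z; rewrite memQ /= => /andP[zy zr].
  by rewrite addnAC mem_r memQ /y eqn_add2r.
have si' : s.-2 < i by move: si s_gt1; clear; lia.
have e1 : take i r' = take s.-2 r' ++ x :: drop s.-1 (take i r').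
  rewrite -{1}(cat_take_drop s.-2 (take i r')) take_takel ?(ltnW si') //.
  rewrite (drop_nth 0) ?size_takel ?sz ?(ltnW iN) // nth_take // -/x.
  by rewrite prednK //; move: s_gt1; clear; lia.
have : uniq (take s.-2 r' ++ x :: drop s.-1 (take i r') ++ drop i r').
  by rewrite -cat_cons catA -e1 cat_take_drop.
rewrite cat_uniq cons_uniq mem_cat negb_or => /and3P[_ /hasPn nx1 /andP[/andP[nx2 nx3] _]].
have eq_f u : x \notin u -> map f u = labels_of u.
  move=> xu; apply/eq_in_map => z zu; rewrite /f.
  by have -> : z != x by apply: contraNneq xu => <-.
have ei : nseq s.-1 true ++ U ++ false :: V = (nseq s.-1 true ++ U) ++ false :: V.
  by rewrite catA.
have szU : size (nseq s.-1 true ++ U) = i.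
  by rewrite size_cat size_nseq size_U; move: si s_gt1; clear; lia.
have s2 : s.-1 = s.-2.+1 by move: s_gt1; clear; lia.
have fx : f x = false by rewrite /f eqxx.
rewrite QE map_cat e1 map_cat map_cons fx !eq_f //; first last.
- by apply: nx1; rewrite mem_head.
- by apply: contra nx3; rewrite -[i.+1]add1n -drop_drop => /mem_drop.
rewrite /labels_of map_take !map_drop map_take -/(labels r') w'E ei.
have t1 : take i ((nseq s.-1 true ++ U) ++ false :: V) = nseq s.-1 true ++ U.
  exact: take_size_cat.
have d1 : drop i.+1 ((nseq s.-1 true ++ U) ++ false :: V) = V.
  by rewrite -cat_rcons drop_size_cat // size_rcons szU.
have d2 : drop s.-1 (nseq s.-1 true ++ U) = U by rewrite drop_size_cat ?size_nseq.
have t2 : take s.-2 ((nseq s.-1 true ++ U) ++ false :: V) = nseq s.-2 true.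
  by rewrite -catA take_cat size_nseq s2 ltnSn take_nseq.
rewrite t1 d1 d2 t2 [RHS]wE s2.
by rewrite /= -catA.
Qed.

End Accept.

(** * The candidate key(R) is offered and accepted *)

Section Key.
Variable r : seq nat.
Hypotheses (rr : rank_seq r) (ntop : labels r != top) (d_gt0 : 0 < m %% n).

Let w := labels r.
Let j := below r.
Let c := count_mem true (take j w).
Let s := s_pos w.

Let dw : is_dyck w. Proof. exact: labels_dyck. Qed.
Let srt : sorted ltn r. Proof. by case/and3P: rr. Qed.
Let jN : j <= size w. Proof. by rewrite size_labels count_size. Qed.
Let r_pos : N < last 0 r. Proof. exact: last_gt. Qed.

Let index_le x : x \in r -> x < N -> (index x r).+1 <= j.
Proof.
move=> xr xN; rewrite -count_leq_index //; apply: sub_count => z /= zx.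
exact: leq_ltn_trans xN.
Qed.

Let sE : s = (index n r).+1. Proof. exact: s_posE. Qed.

Let sj : s <= j.
Proof. by rewrite sE index_le ?(nr m_gt0 n_gt0 co_mn rr) // -[X in X < _]add0n ltn_add2r. Qed.

Let s_gt1 : 1 < s. Proof. exact: (dyck_s_pos_gt1 dw). Qed.

Let tk : take s w = rcons (nseq s.-1 true) false. Proof. exact: dyck_take_s_pos. Qed.

Let s_le_c : s.-1 <= c.
Proof.
rewrite (_ : s.-1 = count_mem true (take s w)) ?count_take_mono //.
by rewrite tk -cats1 count_cat count_nseq /= mul1n !addn0.
Qed.

Let c_gt0 : 0 < c. Proof. by move: s_le_c s_gt1; clear; lia. Qed.

Let c_le : c <= size w.
Proof. by apply: leq_trans (count_size _ _) _; rewrite size_take_min geq_minr. Qed.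

Let pj : pos true c w <= j. Proof. by rewrite posP. Qed.

Let jp : j < pos true c.+1 w. Proof. by rewrite ltnNge posP // -/c ltnn. Qed.

Let Lseq_neq : Lseq r <> r.
Proof.
move=> e; have := codefect_Lseq m_gt0 n_gt0 co_mn rr r_pos; rewrite e.
by move/eqP; rewrite (gtn_eqF (leqnn _)).
Qed.

Let labels_Lseq_neq : labels (Lseq r) <> w.
Proof.
move=> e; apply: Lseq_neq; apply: (labels_inj m_gt0 n_gt0 co_mn) e => //.
exact: rank_seq_Lseq.
Qed.

Let labels_LseqE : labels (Lseq r) = moveW w s j. Proof. exact: labels_Lseq. Qed.

(** Otherwise only W would stand between [s] and [j], and moving the first W there would leave the
    word unchanged, although L changes it. *)
Let sp : s <= pos true c w.
Proof.
rewrite leqNgt; apply/negP => lt; apply: labels_Lseq_neq; rewrite labels_LseqE.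
have s_le : s <= size w := leq_trans sj jN.
have ec : c = s.-1.
  apply/eqP; rewrite eqn_leq s_le_c andbT.
  have := pos_ge true c_gt0 (leqW c_le); move: lt; clear; lia.
rewrite -(moveW_run (leqnn s) sj jN); last first.
  by rewrite -/c ec tk -cats1 count_cat count_nseq /= mul1n !addn0.
rewrite /moveW drop_oversize ?size_take_min ?geq_minl //= -cat_rcons.
rewrite -[RHS](cat_take_drop s) tk; congr (_ ++ _).
by rewrite -cats1 -[in LHS](take_takel w (leq_pred s)) tk -cats1 take_size_cat ?size_nseq // cats1.
Qed.

Lemma key_child : child w c = labels (Lseq r).
Proof.
rewrite labels_LseqE child_moveW ?(leq_trans pj) //; apply: moveW_run => //.
have cp : c <= count_mem true (take (pos true c w) w).
  by rewrite -(@posP true w (pos true c w) c c_gt0 (leq_trans pj jN)).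
by apply/eqP; rewrite eqn_leq cp andbT count_take_mono.
Qed.

Lemma key_child_neq : child w c != w.
Proof. by apply/eqP; rewrite key_child. Qed.

Lemma key_candidate : c \in candidates m n w.
Proof.
have cn : c <= n.
  rewrite -(count_true_labels m_gt0 n_gt0 co_mn rr) -/w.
  by have := count_take_mono true w jN; rewrite take_size.
rewrite mem_filter mem_iota add1n ltnS c_gt0 cn !andbT.
(* [K = kn + n = m + n - d] is the rank at position [a]. At most [d - 1] ranks lie strictly between
   [K] and [m + n], so the last rank below [m + n] is fewer than [d] places after [a]. *)
set K := (m %/ n).+1 * n.
have KN : K + m %% n = N by rewrite /K mulSn {3}(divn_eq m n); clear; lia.
have K_lt : K < N by rewrite -KN -addn1 leq_add2l.
have [Kr ea] := fpos_index m_gt0 n_gt0 co_mn rr K_lt.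
rewrite /a_pos -/w ea -/K; rewrite (leq_ltn_trans (index_le Kr K_lt) jp) /=.
apply: leq_ltn_trans pj _.
have -> : j = (index K r).+1 + count (fun z => K < z < N) r.
  rewrite -count_leq_index // /j; elim: (r) => //= a u ->.
  by case: (leqP a K) => aK; rewrite ?(leq_ltn_trans aK K_lt) //= ?add0n; clear; lia.
rewrite ltn_add2l -size_filter.
have u : uniq r by case/and3P: rr => /and3P[].
have := uniq_leq_size (filter_uniq (fun z => K < z < N) u) (s2 := iota K.+1 (m %% n).-1).
rewrite size_iota => h; apply: leq_ltn_trans (h _) _; last by rewrite prednK.
move=> z; rewrite mem_filter mem_iota => /andP[/andP[-> zN] _] /=.
by rewrite addSnnS prednK // KN.
Qed.

Lemma key_accept : accept m n w c (child w c) (Lseq r) = Some r.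
Proof.
set u := behead r; set t := head 0 u; set j0 := count (fun x => x < N) u.
have r0 : 0 \in r by case/and3P: rr.
have rE : r = 0 :: u.
  by rewrite /u; case: (r) r0 (index0 rr) => //= a v _; case: eqVneq => // ->.
have srt_u : sorted ltn u by move: srt; rewrite rE => /path_sorted.
have j0E : j = j0.+1 by rewrite /j rE /= addn_gt0 m_gt0.
have t_le z : z \in u -> t <= z.
  rewrite /t; case: (u) srt_u => //= a v p; rewrite in_cons => /orP[/eqP -> //|zv].
  by apply: ltnW; have /allP := order_path_min ltn_trans p; apply.
have nu : n \in u.
  by have := nr m_gt0 n_gt0 co_mn rr; rewrite {1}rE in_cons (gtn_eqF n_gt0).
have i_n : nth 0 u s.-2 = n.
  have -> : nth 0 u s.-2 = nth 0 r s.-1.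
    by rewrite rE -[s.-1]prednK // -ltnS prednK // ltnW.
  by rewrite sE /= nth_index // (nr m_gt0 n_gt0 co_mn rr).
have ij : s.-2 < j0 by move: sj s_gt1; rewrite j0E; clear; lia.
have j0u : j0 <= size u by apply: count_size.
have st : size (take j0 u) = j0 by rewrite size_takel.
have LseqE : Lseq r = [seq z - t | z <- take j0 u ++ N :: drop j0 u] by [].
have szl : size (Lseq r) = N by apply: rank_seq_size; apply: rank_seq_Lseq.
have j0N : j0 < N by rewrite -szl LseqE size_map size_cat st /=; clear; lia.
have xE : term (Lseq r) s.-1 = n - t.
  rewrite /term LseqE (nth_map 0); last first.
    by rewrite size_cat st; apply: leq_trans ij (leq_addr _ _).
  by rewrite nth_cat st ij nth_take // i_n.
have tn : t <= n := t_le _ nu.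
(* The term looked up by [accept] is the image of the inserted [m + n], which stands at index
   [j0]. *)
have yE : n - t + m = nth 0 (Lseq r) j0.
  rewrite LseqE (nth_map 0); last by rewrite size_cat st /=; clear; lia.
  by rewrite nth_cat st ltnn subnn /=; move: tn; clear; lia.
have /and3P[/and3P[ul _ _] _ _] := rank_seq_Lseq m_gt0 n_gt0 co_mn rr.
rewrite /accept -/s xE yE index_uniq ?szl // mem_nth ?szl //=.
have -> : nth true (child w c) j0 = false.
  rewrite key_child labels_LseqE moveW_split // catA nth_cat.
  have -> : size (nseq s.-1 true ++ drop s (take j w)) = j0.
    rewrite size_cat size_nseq size_drop size_takel // j0E.
    by move: sj s_gt1; rewrite j0E; clear; lia.
  by rewrite ltnn subnn.
have jp' : j <= (pos true c.+1 w).-1 by rewrite -ltnS prednK.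
rewrite -j0E pj jp' /= subKn // LseqE -map_take -map_drop j0E.
rewrite take_size_cat // -cat_rcons drop_size_cat ?size_rcons ?st //.
rewrite -map_cat cat_take_drop -map_comp rE.
congr (Some (_ :: _)); rewrite -[RHS]map_id; apply/eq_in_map => z zu /=.
by rewrite subnK // t_le.
Qed.

End Key.

End Search.

(** * The search tree *)

Lemma size_candidates (m n : nat) (w : word) :
  0 < m %% n -> count_mem true w = n -> size (candidates m n w) <= m %% n.
Proof.
move=> d_gt0 ct; rewrite /candidates; set a := a_pos m n w; set cs := filter _ _.
(* Only the smallest candidate can have S_c at or before [a], since S_{c+1} is already behind [a].
   Hence [f] is strictly increasing, with values in the [d] places from [a] on. *)
pose f c := maxn a (pos true c w).
have csP c : c \in cs ->
    [/\ 0 < c <= n, a < pos true c.+1 w & pos true c w < a + m %% n].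
  by rewrite mem_filter mem_iota add1n ltnS => /andP[/andP[-> ->] ->].
have lt_f c1 c2 : c1 \in cs -> c2 \in cs -> c1 < c2 -> f c1 < f c2.
  move=> /csP[/andP[c1_gt0 _] a1 _] /csP[/andP[c2_gt0 c2n] _ _] c12.
  set p2 := pos true c2 w; have p2w : p2 <= size w by rewrite posP // take_size ct.
  have h : c2 <= count_mem true (take p2 w) by rewrite -posP.
  have p12 : pos true c1.+1 w <= p2 by rewrite posP // (leq_trans c12).
  have p2_gt0 : 0 < p2 by [].
  have p1 : pos true c1 w < p2.
    rewrite -[p2]prednK // ltnS posP //; last by rewrite (leq_trans (leq_pred _)).
    have := count_takeS true w p2.-1; rewrite prednK //.
    by move: h c12; clear; lia.
  by rewrite /f -/p2 gtn_max !leq_max p1 (leq_trans a1 p12) !orbT.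
have inj : {in cs &, injective f}.
  move=> c1 c2 h1 h2 e; case: (ltngtP c1 c2) => // lt.
    by have := lt_f _ _ h1 h2 lt; rewrite e ltnn.
  by have := lt_f _ _ h2 h1 lt; rewrite e ltnn.
rewrite -(size_map f) -(size_iota a (m %% n)); apply: uniq_leq_size.
  by rewrite map_inj_in_uniq // filter_uniq // iota_uniq.
move=> _ /mapP[c /csP[_ ac pc] ->]; rewrite mem_iota leq_maxl gtn_max pc andbT.
by rewrite -[X in X < _]addn0 ltn_add2l.
Qed.

Section Main.
Variables m n : nat.
Hypotheses (m_gt0 : 0 < m) (n_gt0 : 0 < n) (co_mn : coprime m n).
Hypothesis d_gt0 : 0 < m %% n.
Variable order : word -> seq nat -> seq nat.
Hypothesis orderP : forall w cs, perm_eq (order w cs) cs.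
Local Notation N := (m + n).
Local Notation rank_seq := (rank_seq m n).
Local Notation labels := (labels m).
Local Notation is_dyck := (is_dyck m n).
Local Notation Lseq := (Lseq m n).
Local Notation top := (top_word m n).
Local Notation below := (count (fun x => x < N)).
Local Notation codefect := (codefect m n).

Definition decreasing := forall w cs, sorted geq (order w cs).

(** The exact depth is tied to decreasing orders: then the candidates tried before key(R) exceed it,
    which bounds their trees. *)
Definition good_tree (r : seq nat) (t : search_tree) :=
  [/\ max_children t <= m %% n, output_depth t = codefect r,
      codefect r <= depth t & decreasing -> depth t = codefect r].

Definition solved (w : word) (r : seq nat) (t : search_tree) :=
  (forall f, W_sum w < f -> reciphi m n order f w = Some (Some r, t))
  /\ good_tree r t.

Section Node.
Variables (w : word) (r : seq nat).
Hypotheses (dw : is_dyck w) (rr : rank_seq r) (er : labels r = w) (ntop : w != top).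
Hypothesis ih : forall w' r', is_dyck w' -> W_sum w' < W_sum w ->
  rank_seq r' -> labels r' = w' -> exists t, solved w' r' t.

Let c0 := count_mem true (take (below r) w).

Let ntop' : labels r != top. Proof. by rewrite er. Qed.

Let c0_child : child w c0 = labels (Lseq r).
Proof. by rewrite /c0 -er; apply: key_child. Qed.

Let c0_neq : child w c0 != w.
Proof. by rewrite /c0 -er; apply: key_child_neq. Qed.

Let c0_cand : c0 \in candidates m n w.
Proof. by rewrite /c0 -er; apply: key_candidate. Qed.

Let c0_accept : accept m n w c0 (child w c0) (Lseq r) = Some r.
Proof. by rewrite /c0 -er; apply: key_accept. Qed.

Let child_tree c : c \in candidates m n w -> child w c != w ->
  exists r' t, [/\ rank_seq r', labels r' = child w c & solved (child w c) r' t].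
Proof.
move=> hc ne; have [dc lt] := child_dyck m_gt0 n_gt0 co_mn dw hc ne.
have [r' rr' er'] := dyck_onto m_gt0 n_gt0 co_mn dc.
by have [t st] := ih dc lt rr' er'; exists r', t.
Qed.

Let accept_only c r1 r2 : c \in candidates m n w -> child w c != w ->
  rank_seq r1 -> labels r1 = child w c -> accept m n w c (child w c) r1 = Some r2 ->
  r2 = r /\ c = c0.
Proof.
move=> hc ne rr1 er1 acc.
have er2 : r2 = r.
  apply: (labels_inj m_gt0 n_gt0 co_mn) => //.
    exact: (accept_rank_seq m_gt0 n_gt0 co_mn dw hc ne rr1 er1 acc).
  by rewrite er (accept_labels m_gt0 n_gt0 co_mn dw hc ne rr1 er1 acc).
split=> //; rewrite /c0 -er2.
by rewrite (accept_count m_gt0 n_gt0 co_mn dw hc ne rr1 er1 acc).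
Qed.

(** Stated for every list that still contains [c0], to allow induction. The start value [x] is
    arbitrary because the last subtree decides the output depth. *)
Let loop cs : {subset cs <= candidates m n w} -> c0 \in cs ->
  exists ts, [/\
    forall f, W_sum w <= f ->
      try_candidates m n (reciphi m n order f) w cs = Some (Some r, ts),
    size ts <= size cs,
    forall x, foldl (fun _ u => (output_depth u).+1) x ts = codefect r,
    foldr (fun u h => maxn (max_children u) h) 0 ts <= m %% n
  & codefect r <= foldr (fun u h => maxn (depth u).+1 h) 0 ts /\
    (decreasing -> sorted geq cs ->
      foldr (fun u h => maxn (depth u).+1 h) 0 ts = codefect r)].
Proof.
have cl := codefect_Lseq m_gt0 n_gt0 co_mn rr (last_gt m_gt0 n_gt0 co_mn rr ntop').
elim: cs => // c cs IH sub c0_in.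
have hc : c \in candidates m n w by apply: sub; rewrite mem_head.
have sub' : {subset cs <= candidates m n w}.
  by move=> a acs; apply: sub; rewrite in_cons acs orbT.
have unfold f : try_candidates m n (reciphi m n order f) w (c :: cs) =
    if child w c == w then try_candidates m n (reciphi m n order f) w cs else
    if reciphi m n order f (child w c) is Some (o', t') then
      if obind (accept m n w c (child w c)) o' is Some r
      then Some (Some r, [:: t'])
      else if try_candidates m n (reciphi m n order f) w cs is Some (o, ts)
           then Some (o, t' :: ts) else None
    else None by [].
case: (eqVneq (child w c) w) => [ec|ne].
  have nc0 : c0 != c by apply: contraTneq c0_neq => ->; rewrite ec eqxx.
  have c0_in' : c0 \in cs by move: c0_in; rewrite in_cons (negPf nc0).
  have [ts [h1 h2 h3 h4 [h5 h6]]] := IH sub' c0_in'; exists ts; split=> //.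
  - by move=> f hf; rewrite unfold ec eqxx h1.
  - exact: leq_trans h2 (leqnSn _).
  by split=> // dec /path_sorted; apply: h6.
have [r1 [t1 [rr1 er1 [s1 [g1 g2 g3 g4]]]]] := child_tree hc ne.
have [_ lt] := child_dyck m_gt0 n_gt0 co_mn dw hc ne.
case: (eqVneq c c0) => [e|nc0].
  have er1' : r1 = Lseq r.
    apply: (labels_inj m_gt0 n_gt0 co_mn) => //; first exact: rank_seq_Lseq.
    by rewrite er1 e c0_child.
  exists [:: t1]; rewrite er1' in g2 g3 g4 s1; split=> //.
  - by move=> f hf; rewrite unfold (negPf ne) s1 ?(leq_trans lt) //= e c0_accept.
  - by rewrite /= g2.
  by rewrite /= maxn0 -cl; split=> // dec _; rewrite g4.
have c0_in' : c0 \in cs by move: c0_in; rewrite in_cons eq_sym (negPf nc0).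
have [ts [h1 h2 h3 h4 [h5 h6]]] := IH sub' c0_in'; exists (t1 :: ts); split=> //.
- move=> f hf; rewrite unfold (negPf ne) s1 ?(leq_trans lt) //= h1 //.
  case acc: (accept _ _ _ _ _ _) => [r2|] //.
  by have [_ e] := accept_only hc ne rr1 er1 acc; rewrite e eqxx in nc0.
- by move=> x /=; apply: h3.
- by rewrite /= geq_max g1.
split; first by rewrite /= leq_max h5 orbT.
move=> dec srt; rewrite /= g4 // h6 //; last exact: path_sorted srt.
(* [c0] comes later in a decreasing list, so [c] is at least [c0] and the tails of its child contain
   no more S than those of L(R). *)
apply/maxn_idPr; rewrite -cl ltnS; apply: codefect_le => //.
  exact: rank_seq_Lseq.
move=> q; rewrite er1 -c0_child; apply: (child_tails m_gt0 n_gt0 co_mn) => //.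
have tr : transitive geq by move=> x y z /= yx zy; apply: leq_trans yx.
by have /allP/(_ _ c0_in') := order_path_min tr srt.
Qed.

Lemma solve_node : exists t, solved w r t.
Proof.
have p := orderP w (candidates m n w).
have [||ts [h1 h2 h3 h4 [h5 h6]]] := @loop (order w (candidates m n w)).
- by move=> c; rewrite (perm_mem p).
- by rewrite (perm_mem p).
exists (Node w ts); split.
  case=> // f hf; rewrite /= (negPf ntop) h1 //.
split=> //=; rewrite ?h3 //.
  rewrite geq_max h4 andbT (leq_trans h2) // (perm_size p) size_candidates //.
  by case/dyckE: dw.
by move=> dec; apply: h6.
Qed.

End Node.

Lemma reciphi_solved w r : is_dyck w -> rank_seq r -> labels r = w ->
  exists t, solved w r t.
Proof.
have [l] := ubnP (W_sum w); elim: l w r => // l ih w r wl dw rr er.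
case: (eqVneq w top) => [ew|nw]; last first.
  apply: solve_node => // w' r' dw' lt; apply: ih => //.
  exact: leq_trans lt _.
have e0 : r = iota 0 N.
  apply: (labels_inj m_gt0 n_gt0 co_mn) => //; first exact: rank_seq_iota.
  by rewrite er ew labels_iota.
exists (Node w [::]); split; first by case=> // f _; rewrite /= ew eqxx e0.
by split; rewrite //= e0 codefect_iota.
Qed.

(** [key] admits the rank [m + n] and [below] does not; they agree because [m + n] is in the class
    of 0 and hence is not a rank. *)
Lemma key_labels D : is_dyck D ->
  key m n D = count_mem true (take (below (sorted_ranks m n D)) (sw m n D)).
Proof.
move=> dD; have rr := sorted_ranks_rank_seq m_gt0 n_gt0 co_mn dD.
have /and3P[_ srt _] := rr; have p := perm_sorted_ranks m n D.
rewrite sw_labels // /labels -map_take take_down //; last first.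
  by move=> x y xy; apply: leq_ltn_trans.
rewrite count_map count_filter -(permP (_ : perm_eq (ranks m n D) _)) 1?perm_sym //.
rewrite /key count_map; apply: eq_in_count => i; rewrite mem_iota add0n => iN /=.
have iN' : i <= N by apply: ltnW.
rewrite (nth_dyck m_gt0 n_gt0 co_mn dD iN) eqb_id (perm_mem p); congr (_ && _).
rewrite leq_eqVlt; case: eqP => // e; have := N_notin m_gt0 n_gt0 co_mn rr.
by rewrite -[X in X \notin _]e (perm_mem p) point_rank_in.
Qed.

End Main.

Theorem mainTheorem2 (m n k d : nat) (m_gt0 : 0 < m) (n_gt0 : 0 < n)
    (co_mn : coprime m n) (def_m : m = k * n + d) (k_ge1 : 1 <= k)
    (d_bounds : 1 <= d < n)
    (order : word -> seq nat -> seq nat)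
    (orderP : forall tau cs, perm_eq (order tau cs) cs)
    (sigma : word) (dyck_sigma : is_dyck m n sigma) :
  (* the algorithm terminates and decides compatibility *)
  exists (o : option (seq nat)) (t : search_tree),
    [/\ halts_with m n order sigma o t,
        (if o is Some r then compatible m n sigma r
         else forall r, ~~ compatible m n sigma r),
        (* s and a are the positions of n and kn + n *)
        (forall r, sigma <> top_word m n -> compatible m n sigma r ->
           term r (s_pos sigma) = n /\ term r (a_pos m n sigma) = k * n + n),
        (* an accepted candidate is key(R), and then sigma' = sigma(L(R)) *)
        (forall c r' t' r,
           sigma <> top_word m n ->
           c \in candidates m n sigma -> child sigma c <> sigma ->
           halts_with m n order (child sigma c) (Some r') t' ->
           accept m n sigma c (child sigma c) r' = Some r ->
           exists D D' : word,
             [/\ is_dyck m n D, sw m n D = sigma & sorted_ranks m n D = r] /\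
             [/\ key m n D = c, is_dyck m n D',
                 sorted_ranks m n D' = Lop m n (ranks m n D)
               & sw m n D' = child sigma c])
      & (* the search tree *)
        forall D, is_dyck m n D -> sw m n D = sigma ->
          max_children t <= d /\
          exists2 E, is_rank_complement m n D E &
            [/\ output_depth t = area m n E,
                area m n E <= depth t
              & (forall tau cs, sorted geq (order tau cs)) ->
                depth t = area m n E]].
Proof.
have /andP[d1 dn] := d_bounds.
have ek : m %/ n = k by rewrite def_m divnMDl // divn_small ?addn0.
have ed : m %% n = d by rewrite def_m modnMDl modn_small.
have d_gt0 : 0 < m %% n by rewrite ed.
have [r rr er] := dyck_onto m_gt0 n_gt0 co_mn dyck_sigma.
have [t [run [g1 g2 g3 g4]]] :=
  reciphi_solved m_gt0 n_gt0 co_mn d_gt0 orderP dyck_sigma rr er.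
have [ct cf _ _] := dyckE dyck_sigma.
have compE r1 : compatible m n sigma r1 = rank_seq m n r1 && (sigma == labels m r1).
  exact: compatibleE.
exists (Some r), t; split.
- by exists (W_sum sigma).+1 => f; apply: run.
- by rewrite compE rr er eqxx.
- move=> r1 _; rewrite compE => /andP[rr1 /eqP e1]; rewrite e1; split.
    rewrite -[RHS]mul1n; apply: (term_fpos m_gt0 n_gt0 co_mn rr1).
    by rewrite mul1n -[X in X < _]add0n ltn_add2r.
  rewrite /a_pos (term_fpos m_gt0 n_gt0 co_mn rr1) ek mulSn addnC //.
  by rewrite ltn_add2r def_m -addn1 leq_add2l.
- move=> c r' t' r1 ntop hc /eqP ne [F hF] acc.
  have [dc _] := child_dyck m_gt0 n_gt0 co_mn dyck_sigma hc ne.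
  have [r2 rr2 er2] := dyck_onto m_gt0 n_gt0 co_mn dc.
  have [t2 [run2 _]] := reciphi_solved m_gt0 n_gt0 co_mn d_gt0 orderP dc rr2 er2.
  (* The assumed run and the solved one come with different fuel bounds; at their sum both apply. *)
  have e2 : r' = r2.
    have := hF (F + (W_sum (child sigma c)).+1) (leq_addr _ _).
    by rewrite run2 ?leq_addl // => -[->].
  rewrite {}e2 in hF acc *.
  have rr1 := accept_rank_seq m_gt0 n_gt0 co_mn dyck_sigma hc ne rr2 er2 acc.
  have es := accept_labels m_gt0 n_gt0 co_mn dyck_sigma hc ne rr2 er2 acc.
  have el := accept_Lseq m_gt0 n_gt0 co_mn dyck_sigma hc ne rr2 er2 acc.
  have ec := accept_count m_gt0 n_gt0 co_mn dyck_sigma hc ne rr2 er2 acc.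
  have [D [dD swD sD]] := dyck_of_rank_seq m_gt0 n_gt0 co_mn rr1.
  have [D' [dD' swD' sD']] := dyck_of_rank_seq m_gt0 n_gt0 co_mn rr2.
  exists D, D'; split; first by rewrite swD es.
  split=> //; last by rewrite swD' er2.
    by rewrite key_labels // sD swD es ec.
  rewrite sD' -el (Lop_Lseq m_gt0 n_gt0 co_mn rr1) // -sD perm_sym.
  exact: perm_sorted_ranks.
move=> D dD swD; split; first by rewrite -ed.
have [E cE aE] := rank_complement_exists m_gt0 n_gt0 co_mn dD.
exists E => //; suff <- : codefect m n r = area m n E by [].
rewrite aE; congr codefect; apply: (labels_inj m_gt0 n_gt0 co_mn) => //.
  exact: sorted_ranks_rank_seq.
by rewrite er -swD sw_labels.
Qed.
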